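(* Let $\Omega\subset\mathbb{R}^d$ be open and nonempty and let $\gamma:\mathbb{R}^d\times\mathbb{R}^d\to[0,\infty)$ be measurable with $$\|\gamma(\cdot,x)\|_{L^\infty(\Gamma)}+\int_\Gamma\gamma(x,y)\,dy<\infty\ \text{ for a.e. }x\in\Omega,\qquad \|\gamma(\cdot,y)\|_{L^\infty(\Omega)}+\int_\Omega\gamma(y,x)\,dx<\infty\ \text{ for a.e. }y\in\Gamma.$$ Let the measurable function $u:\mathbb{R}^d\to\mathbb{R}$ satisfy $$\int_\Omega|u(x)|\,dx<\infty\quad\text{and}\quad\int_\Omega\int_{\mathbb{R}^d}|u(x)\gamma(x,y)-u(y)\gamma(y,x)|\,dy\,dx<\infty.$$ Let $\alpha:\Gamma\to[0,1]$ be measurable and $g\in L^1(\Gamma)$ such that for all $y\in\Gamma$ $$\alpha(y)u(y)-(1-\alpha(y))\int_\Omega u(x)\gamma(x,y)-u(y)\gamma(y,x)\,dx=g(y).$$ Define $\gamma_\alpha:\Omega\times\Omega\to[0,\infty]$ by $$\gamma_\alpha(x,z)=\gamma(x,z)+\int_\Gamma\frac{(1-\alpha(y))\gamma(x,y)\gamma(y,z)}{(1-\alpha(y))\int_\Omega\gamma(y,v)\,dv+\alpha(y)}\,dy.$$ Then for a.e. $x\in\Omega$ $$\begin{aligned}\mathcal{L}_\gamma u(x)&=\int_{\mathbb{R}^d}u(x)\gamma(x,y)-u(y)\gamma(y,x)\,dy\\&=\int_\Omega u(x)\gamma_\alpha(x,z)-u(z)\gamma_\alpha(z,x)\,dz\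\&\quad+u(x)\Big(\int_{\widehat\Gamma\setminus\Gamma}\gamma(x,y)\,dy+\int_\Gamma\frac{\alpha(y)\gamma(x,y)}{(1-\alpha(y))\int_\Omega\gamma(y,z)\,dz+\alpha(y)}\,dy\Big)\\&\quad-\int_\Gamma\frac{g(y)\gamma(y,x)}{(1-\alpha(y))\int_\Omega\gamma(y,v)\,dv+\alpha(y)}\,dy.\end{aligned}$$
   Context: Measurability is with respect to Lebesgue measure. $\Gamma:=\{y\in\mathbb{R}^d\setminus\Omega:\int_\Omega\gamma(y,x)\,dx>0\}$ and $\widehat\Gamma:=\{y\in\mathbb{R}^d\setminus\Omega:\int_\Omega\gamma(y,x)+\gamma(x,y)\,dx>0\}$. The nonlocal operator is $\mathcal{L}_\gamma u(x):=\int_{\mathbb{R}^d}u(x)\gamma(x,y)-u(y)\gamma(y,x)\,dy$. The usual convention $0\cdot\infty=0$ of measure theory is used. *)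

(* Defs.v *)
From HB Require Import structures.
From mathcomp Require Import all_boot all_order all_algebra.
From mathcomp Require Import all_classical all_reals all_analysis.

Set Implicit Arguments.
Unset Strict Implicit.
Unset Printing Implicit Defensive.

Import Order.TTheory GRing.Theory Num.Theory.
Import numFieldTopology.Exports numFieldNormedType.Exports.

Local Open Scope classical_set_scope.
Local Open Scope ring_scope.

Section rV_measurable.
Context {disp : measure_display} {T : measurableType disp}.
Variable n : nat.

Definition rV_coord (i : 'I_n) (v : 'rV[T]_n) : T := v ord0 i.

Let rV_set0 : g_sigma_preimage rV_coord set0.
Proof. exact: sigma_algebra0. Qed.

Let rV_setC A : g_sigma_preimage rV_coord A -> g_sigma_preimage rV_coord (~` A).
Proof. exact: sigma_algebraC. Qed.

Let rV_bigcup (F : _^nat) : (forall i, g_sigma_preimage rV_coord (F i)) ->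
  g_sigma_preimage rV_coord (\bigcup_i (F i)).
Proof. exact: sigma_algebra_bigcup. Qed.

(* The product sigma-algebra on row vectors, as the library does for tuples;
   over the reals it is the Borel sigma-algebra. *)
HB.instance Definition _ := @isMeasurable.Build (measure_tuple_display disp)
  'rV[T]_n (g_sigma_preimage rV_coord) rV_set0 rV_setC rV_bigcup.

Lemma measurable_rV_coord (i : 'I_n) : measurable_fun setT (rV_coord i).
Proof.
move=> _ Y mY; rewrite setTI; apply: sub_sigma_algebra => /=.
rewrite -bigcup_seq/=; exists i => /=; first by rewrite mem_index_enum.
by exists Y => //; rewrite setTI.
Qed.

Lemma measurable_fun_rV {disp' : measure_display} {S : measurableType disp'}
    (f : S -> 'rV[T]_n) :
  (forall i, measurable_fun setT (rV_coord i \o f)) -> measurable_fun setT f.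
Proof.
move=> mf _ Y mY; rewrite setTI.
suff : <<s \big[setU/set0]_(i < n)
    preimage_set_system setT (@rV_coord i) measurable >> `<=`
    [set A | measurable (f @^-1` A)] by apply.
apply: smallest_sub.
  split=> [|A mA|F mF]/=.
  - by rewrite preimage_set0.
  - rewrite setTD preimage_setC; exact: measurableC.
  - by rewrite preimage_bigcup; exact: bigcupT_measurable.
rewrite -bigcup_seq => A [/= i _ [B mB <-]]; rewrite setTI /=.
by rewrite -comp_preimage -[X in measurable X]setTI; exact: mf.
Qed.
End rV_measurable.

Section lebesgue_rec.
Variables (R : realType) (d : nat).
Local Notation rV n := 'rV[measurableTypeR R]_n.
Local Open Scope ereal_scope.

Definition rV_cons (p : measurableTypeR R * rV d) : rV d.+1 :=
  row_mx (const_mx p.1 : 'rV_1) p.2.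

Definition rV_uncons (v : rV d.+1) : measurableTypeR R * rV d :=
  (v ord0 ord0, \row_i v ord0 (lift ord0 i)).

Lemma rV_consE0 p : rV_cons p ord0 ord0 = p.1.
Proof.
by rewrite mxE; case: splitP => // j _; rewrite mxE.
Qed.

Lemma rV_consES p (i : 'I_d) : rV_cons p ord0 (lift ord0 i) = p.2 ord0 i.
Proof.
rewrite mxE; case: splitP => [j|k /= ik]; first by rewrite ord1.
by congr (p.2 _ _); apply: val_inj; case: ik.
Qed.

Lemma rV_consK : cancel rV_cons rV_uncons.
Proof.
move=> [t v]; rewrite /rV_uncons rV_consE0; congr pair.
by apply/rowP => i; rewrite mxE rV_consES.
Qed.

Lemma measurable_rV_cons : measurable_fun setT rV_cons.
Proof.
apply: measurable_fun_rV => i; have [j ->|->] := unliftP ord0 i.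
  rewrite (_ : _ \o _ = rV_coord j \o snd).
    by apply: measurableT_comp => //; exact: measurable_rV_coord.
  by apply/funext => p; rewrite /rV_coord /= rV_consES.
rewrite (_ : _ \o _ = fst) //.
by apply/funext => p; rewrite /rV_coord /= rV_consE0.
Qed.

Lemma measurable_rV_uncons : measurable_fun setT rV_uncons.
Proof.
apply/measurable_fun_pairP; split; first exact: (@measurable_rV_coord _ _ d.+1).
apply: measurable_fun_rV => i.
rewrite (_ : _ \o _ = rV_coord (lift ord0 i)); first exact: measurable_rV_coord.
by apply/funext => v; rewrite /rV_coord /= mxE.
Qed.

Variable mu : {sigma_finite_measure set (rV d) -> \bar R}.

(* Identifies R^(d+1) with R x R^d. *)
Definition borel_lebesgueS : set (rV d.+1) -> \bar R :=
  pushforward (@lebesgue_measure R \x mu) rV_cons.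


Let borel_lebesgueS0 : borel_lebesgueS set0 = 0.
Proof. by rewrite /borel_lebesgueS /pushforward preimage_set0 measure0. Qed.

Let borel_lebesgueS_ge0 A : 0 <= borel_lebesgueS A.
Proof. by rewrite /borel_lebesgueS /pushforward measure_ge0. Qed.

Let borel_lebesgueS_sigma_additive : semi_sigma_additive borel_lebesgueS.
Proof.
exact: (@measure_semi_sigma_additive _ _ _
  (measure_function_pushforward__canonical__measure_function_Measure
    (@lebesgue_measure R \x mu) measurable_rV_cons)).
Qed.

HB.instance Definition _ := isMeasure.Build _ _ _ borel_lebesgueS
  borel_lebesgueS0 borel_lebesgueS_ge0 borel_lebesgueS_sigma_additive.

Let borel_lebesgueS_sigma_finite : sigma_finite setT borel_lebesgueS.
Proof.
have /sigma_finiteP[F [FT ndF Foo]] := sigma_finiteT (@lebesgue_measure R).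
have /sigma_finiteP[G [GT ndG Goo]] := sigma_finiteT mu.
exists (fun k => rV_uncons @^-1` (F k `*` G k)).
  rewrite -preimage_bigcup (_ : \bigcup_k _ = setT) ?preimage_setT//.
  apply/seteqP; split=> // -[t v] _.
  have [i _ Fi] : (\bigcup_i F i) t by rewrite -FT.
  have [j _ Gj] : (\bigcup_i G i) v by rewrite -GT.
  exists (maxn i j) => //; split => /=.
  - by move: Fi; apply/subsetPset/ndF/leq_maxl.
  - by move: Gj; apply/subsetPset/ndG/leq_maxr.
move=> k; have [mF Fk] := Foo k; have [mG Gk] := Goo k; split.
  rewrite -[X in measurable X]setTI; apply: measurable_rV_uncons => //.
  exact: measurableX.
rewrite /borel_lebesgueS /pushforward -comp_preimage (_ : _ \o _ = id).
  by rewrite preimage_id product_measure1E// lte_mul_pinfty// ge0_fin_numE.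
by apply/funext => p; rewrite /= rV_consK.
Qed.

HB.instance Definition _ := Measure_isSigmaFinite.Build _ _ _ borel_lebesgueS
  borel_lebesgueS_sigma_finite.

End lebesgue_rec.

Fixpoint borel_lebesgue (R : realType) (d : nat) :
    {sigma_finite_measure set 'rV[measurableTypeR R]_d -> \bar R} :=
  match d with
  | 0%N => dirac (0 : 'rV[measurableTypeR R]_0)
  | d'.+1 => borel_lebesgueS (borel_lebesgue R d')
  end.

(* R^d with the Lebesgue (i.e. completed Borel) sigma-algebra and its usual
   topology. *)
Definition Rd (R : realType) (d : nat) : Type :=
  caratheodory_type (mu_ext (borel_lebesgue R d)).

Section Rd_instances.
Variables (R : realType) (d : nat).
Local Open Scope ereal_scope.

HB.instance Definition _ := Measurable.copy (Rd R d)
  (caratheodory_type (mu_ext (borel_lebesgue R d))).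
HB.instance Definition _ := Topological.copy (Rd R d) 'rV[R]_d.

Definition leb : set (Rd R d) -> \bar R :=
  @completed_measure_extension _ _ _ (borel_lebesgue R d).

HB.instance Definition _ := Measure.on leb.

Let leb_sigma_finite : sigma_finite setT leb.
Proof.
exact/completed_measure_extension_sigma_finite/sigma_finiteT.
Qed.

HB.instance Definition _ := Measure_isSigmaFinite.Build _ _ _ leb
  leb_sigma_finite.
End Rd_instances.
Arguments leb {R d}.

(* R^d x R^d with the completion of the product sigma-algebra, i.e. the
   Lebesgue sigma-algebra of R^(2d); it is not the canonical (uncompleted)
   measurable structure of the product type. *)
Definition RdRd (R : realType) (d : nat) : measurableType _ :=
  caratheodory_type (mu_ext (@leb R d \x @leb R d)%E).

Section nonlocal.
Variables (R : realType) (d : nat).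
Implicit Types (Omega A : set (Rd R d)) (gamma : Rd R d * Rd R d -> R).
Implicit Types (u alpha : Rd R d -> R) (x y z : Rd R d).
Local Open Scope ereal_scope.

Definition Linfty_norm A (f : Rd R d -> R) : \bar R :=
  'N[leb]_+oo[(EFin \o f) \_ A].

(* When gamma is only measurable for the completed product, gamma (y, -) may be
   non-measurable for y in a null set; the library integral is total, so this
   affects the set below on a null set only. *)
Definition nonlocal_boundary Omega gamma : set (Rd R d) :=
  [set y | ~ Omega y /\ 0 < \int[leb]_(x in Omega) (gamma (y, x))%:E].

Definition nonlocal_boundary_sym Omega gamma : set (Rd R d) :=
  [set y | ~ Omega y /\
    0 < \int[leb]_(x in Omega) (gamma (y, x) + gamma (x, y))%:E].

Definition nonlocal_op gamma u x : \bar R :=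
  \int[leb]_y (u x * gamma (x, y) - u y * gamma (y, x))%:E.

(* Possibly +oo, on a null set of y; extended real products satisfy
   0 * +oo = 0, and x / +oo = 0. *)
Definition robin_denom Omega gamma alpha y : \bar R :=
  (1 - alpha y)%:E * \int[leb]_(v in Omega) (gamma (y, v))%:E + (alpha y)%:E.

Definition gamma_alpha Omega gamma alpha x z : \bar R :=
  (gamma (x, z))%:E +
  \int[leb]_(y in nonlocal_boundary Omega gamma)
    (((1 - alpha y) * gamma (x, y) * gamma (y, z))%:E /
     robin_denom Omega gamma alpha y).
End nonlocal.

(* Main.v *)
(** Write k(y) for the integral of gamma(y, .) over Omega and
  D = (1 - alpha) k + alpha.  On Gamma the Robin condition can be solved for
  the boundary values: u(y) = r g + p V(y), where p = (1 - alpha) / D,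
  r = 1 / D and V(y) is the integral of u(x) gamma(x, y) over Omega.  Insert
  this into the incoming part of the operator on Gamma, split the outgoing part
  by p k + q = 1 with q = alpha / D, and exchange the order of integration.
  Off Omega and Gamma nothing comes back into Omega, so only the killing term
  on Gamma_hat \ Gamma is left there.

  Two integrability points make the exchange legitimate for a.e. x.  The
  integral of |u(z)| gamma(z, y) over z in Omega is at most h(y) + |u(y)| k(y),
  where h, the total variation of the flux through y, is integrable on Gamma;
  multiplied by p gamma(y, x), the first part is integrable in x because
  p k <= 1, the second is at most |u(y)| gamma(y, x).  For the source term,
  either r <= 2, and gamma(., x) is bounded, or r k <= 2, and Tonelli applies.

  Since gamma is measurable only for the completed product, Tonelli and Fubini
  are used for a product-measurable ga equal to gamma a.e.; for a.e. point the
  sections of gamma and ga agree a.e., and the Lebesgue measure is complete. *)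

Require Import Defs.
From mathcomp Require Import all_boot all_order all_algebra.
From mathcomp Require Import all_classical all_reals all_analysis.
From mathcomp Require Import measurable_realfun ess_sup_inf.
From mathcomp Require Import ring lra.
Import Order.TTheory GRing.Theory Num.Theory.
Import numFieldTopology.Exports numFieldNormedType.Exports.
Set Implicit Arguments.
Unset Strict Implicit.
Unset Printing Implicit Defensive.
Local Open Scope classical_set_scope.
Local Open Scope ring_scope.
Local Open Scope ereal_scope.

(** * Measurability for completed measures *)

Section caratheodory_approximation.
Context {R : realType} {disp : measure_display} {T : measurableType disp}.
Variable mu : {measure set T -> \bar R}.
Local Notation mustar := (mu_ext mu).

(** Measurable covers whose measure exceeds the outer measure by at most [1/(n+1)] are intersected;
    if the outer measure is infinite, the whole space serves. *)
Lemma mu_ext_measurable_hull (A : set T) :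
  exists G, [/\ measurable G, A `<=` G & mu G = mustar A].
Proof.
have [Aoo|Afin] := eqVneq (mustar A) +oo.
  exists setT; split => //; apply/eqP; rewrite Aoo -leye_eq -Aoo.
  by rewrite -[leRHS]measurable_mu_extE//; exact: le_mu_ext.
have Afn : mustar A \is a fin_num.
  by rewrite ge0_fin_numE ?mu_ext_ge0// ltey.
have cover n : exists2 G, measurable G /\ A `<=` G &
    mu G <= mustar A + n.+1%:R^-1%:E.
  have n0 : (0 < n.+1%:R^-1 :> R)%R by rewrite invr_gt0.
  have [_ /= [F [mF AF] <-] ltF] := lb_ereal_inf_adherent n0 Afn.
  exists (\bigcup_k F k); first by split => //; exact: bigcupT_measurable.
  apply: le_trans (ltW ltF); apply: measure_sigma_subadditive => //.
  exact: bigcupT_measurable.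
have /choice[F /all_and2[mAF leF]] : forall n, exists G,
    (measurable G /\ A `<=` G) /\ mu G <= mustar A + n.+1%:R^-1%:E.
  by move=> n; have [G] := cover n; exists G.
have mG : measurable (\bigcap_n F n).
  by apply: bigcapT_measurable => n; have [] := mAF n.
have AG : A `<=` \bigcap_n F n by apply: sub_bigcap => n _; have [] := mAF n.
exists (\bigcap_n F n); split => //.
apply/eqP; rewrite eq_le; apply/andP; split; last first.
  by rewrite -[leRHS]measurable_mu_extE//; exact: le_mu_ext.
apply/lee_addgt0Pr => _/posnumP[e]; near \oo => n.
apply: (@le_trans _ _ (mu (F n))).
  apply: le_measure; rewrite ?inE//; first by have [] := mAF n.
  exact: bigcap_inf.
apply: (le_trans (leF n)); rewrite leeD2l// lee_fin ltW//.
by near: n; exact: near_infty_natSinv_lt.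
Unshelve. all: by end_near. Qed.

(** Testing the Caratheodory criterion on a hull [G] of [A] and cancelling the finite outer measure
    of [A] shows that the difference of [G] and [A] has outer measure zero; a hull of this
    difference is the exceptional null set. *)
Lemma caratheodory_ae_measurable_lty (A : set T) :
  mustar.-caratheodory A -> mustar A < +oo ->
  exists2 B, measurable B & {ae mu, forall x, A x <-> B x}.
Proof.
move=> mA Aoo; have [G [mG AG muG]] := mu_ext_measurable_hull A.
have [N [mN GAN muN]] := mu_ext_measurable_hull (G `\` A).
exists G => //; exists N; split => //; last first.
  move=> x /= nAG; apply: GAN; have [Ax|nAx] := pselect (A x).
    by exfalso; apply: nAG; split => // _; exact: AG.
  split => //; apply: contrapT => nGx; apply: nAG; split => //.
have := mA G; rewrite measurable_mu_extE// muG setIidr// => muGA.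
have Afn : mustar A \is a fin_num by rewrite ge0_fin_numE// mu_ext_ge0.
by rewrite muN setDE -[LHS](addeK _ Afn) [X in X - _]addeC -muGA subee.
Qed.

Hypothesis mu_sf : sigma_finite setT mu.

(** [A] is cut along a sigma-finite exhaustion; the countably many exceptional sets together are
    still null. *)
Lemma caratheodory_ae_measurable (A : set T) : mustar.-caratheodory A ->
  exists2 B, measurable B & {ae mu, forall x, A x <-> B x}.
Proof.
move=> mA; have [S ST /all_and2[mS Soo]] := mu_sf.
have /choice[B /all_and2[mB aeB]] : forall n, exists B,
    measurable B /\ {ae mu, forall x, (A `&` S n) x <-> B x}.
  move=> n.
  have [||B] := @caratheodory_ae_measurable_lty (A `&` S n); last by exists B.
    apply: caratheodory_measurable_setI => //.
    exact: caratheodory_measurable_mu_ext.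
  apply: le_lt_trans (Soo n); rewrite -[leRHS]measurable_mu_extE//.
  by apply: le_mu_ext; exact: subIsetr.
exists (\bigcup_n B n); first exact: bigcupT_measurable.
have /ae_foralln : forall n, {ae mu, forall x, (A `&` S n) x <-> B n x} by [].
apply: filterS => x AB; split => [Ax|[n _ /AB[]//]].
have : setT x by []; rewrite ST => -[n _ Sx]; exists n => //.
by apply/(AB n); split.
Qed.

(** A function is determined by its superlevel sets at rational levels, so only countably many sets
    have to be replaced; the new function is the supremum of the levels on the new sets. *)
Lemma caratheodory_ae_measurable_fun (f : T -> R) : (forall x, 0 <= f x)%R ->
  measurable_fun [set: caratheodory_type mustar] (f : caratheodory_type mustar -> R) ->
  exists f' : T -> R, [/\ measurable_fun setT f', (forall x, 0 <= f' x)%R &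
    {ae mu, forall x, f x = f' x}].
Proof.
move=> f0 mf.
(* Codes of no rational are sent to level 0, harmless for the supremum because [f] is
   nonnegative. *)
pose q (n : nat) : R := if @unpickle rat n is Some r then ratr r else 0%R.
have /choice[B /all_and2[mB aeB]] : forall n, exists B,
    measurable B /\ {ae mu, forall x, (q n < f x)%R <-> B x}.
  move=> n.
  have [|B] := @caratheodory_ae_measurable [set x | (q n < f x)%R]; last by exists B.
  have := mf measurableT `]q n, +oo[%classic (measurable_itv _).
  rewrite setTI; congr (_.-caratheodory _); apply/seteqP.
  by split => x /=; rewrite in_itv/= andbT.
pose F (n : nat) (x : T) : \bar R := (q n * \1_(B n) x)%:E.
pose f' (x : T) : \bar R := ereal_sup [set F n x | n in [set: nat]].
have mf' : measurable_fun setT f'.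
  rewrite (_ : f' = fun x => esups (F ^~ x) 0%N).
    apply: measurable_fun_esups => n; apply/measurable_EFinP.
    exact: measurable_funM.
  apply/funext => x; rewrite /f' /esups/=; congr ereal_sup.
  by apply/seteqP; split=> [_ [n _ <-]|_ [n _ <-]]; exists n.
(* [fine] and the absolute value make the candidate real and nonnegative everywhere, also on the
   null set where the supremum may be infinite; almost everywhere they change nothing. *)
exists (fun x => `|fine (f' x)|)%R; split => //.
- by apply: measurableT_comp => //; exact: measurableT_comp.
- have /ae_foralln : forall n, {ae mu, forall x, (q n < f x)%R <-> B n x} by [].
  apply: filterS => x qB.
  suff -> : f' x = (f x)%:E by rewrite /= ger0_norm.
  apply/eqP; rewrite eq_le; apply/andP; split.
    apply: ge_ereal_sup => _ [n _ <-]; rewrite /F lee_fin indicE.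
    have [|] := boolP (x \in B n); last by rewrite mulr0.
    by rewrite inE => /qB /ltW; rewrite mulr1.
  rewrite leNgt; apply/negP => lt_f'.
  have f'0 : 0 <= f' x.
    apply: ereal_sup_ubound; exists (pickle (0%R : rat)) => //.
    by rewrite /F /q pickleK rmorph0 mul0r.
  have f'fn : f' x \is a fin_num.
    by rewrite ge0_fin_numE// (lt_trans lt_f')// ltry.
  move: lt_f'; rewrite -(fineK f'fn) lte_fin => /rat_in_itvoo[r].
  rewrite in_itv/= => /andP[f'r rf].
  have qr : q (pickle r) = ratr r by rewrite /q pickleK.
  have : (ratr r)%:E <= f' x.
    apply: ereal_sup_ubound; exists (pickle r) => //.
    by rewrite /F qr indicE mem_set ?mulr1//; apply/qB; rewrite qr.
  by rewrite -(fineK f'fn) lee_fin leNgt f'r.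
Qed.

End caratheodory_approximation.

(** * Sections of null sets of a product measure *)

Section product_sections.
Context {R : realType} {d1 d2 : measure_display}.
Context {T1 : measurableType d1} {T2 : measurableType d2}.
Variables (m1 : {sigma_finite_measure set T1 -> \bar R}).
Variables (m2 : {sigma_finite_measure set T2 -> \bar R}).

(** The product measure of a null set is the integral of the measures of its sections; as it
    vanishes, almost every section is null. *)
Lemma ae_product_xsection (P : T1 * T2 -> Prop) :
  {ae m1 \x m2, forall p, P p} ->
  {ae m1, forall x, {ae m2, forall y, P (x, y)}}.
Proof.
move=> [N [mN N0 PN]].
have mN' : measurable_fun setT (m2 \o xsection N).
  exact: measurable_fun_xsection.
have [+ _] := ae_eq_integral_abs m1 measurableT mN'.
have -> : \int[m1]_x `|(m2 \o xsection N) x| = 0.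
  rewrite -N0 /product_measure1; apply: eq_integral => x _.
  by rewrite gee0_abs//= measure_ge0.
move=> /(_ erefl); apply: filterS => x /(_ I) xN0.
exists (xsection N x); split => //; first exact: measurable_xsection.
by move=> y /= nP; rewrite /xsection /= inE; exact: PN.
Qed.

Lemma ae_product_ysection (P : T1 * T2 -> Prop) :
  {ae m1 \x m2, forall p, P p} ->
  {ae m2, forall y, {ae m1, forall x, P (x, y)}}.
Proof.
move=> [N [mN N0 PN]].
have mN' : measurable_fun setT (m1 \o ysection N).
  exact: measurable_fun_ysection.
have [+ _] := ae_eq_integral_abs m2 measurableT mN'.
have -> : \int[m2]_x `|(m1 \o ysection N) x| = 0.
  (* Integrating in the other order defines the same product measure, by uniqueness on
     rectangles. *)
  rewrite -N0; transitivity ((m1 \x^ m2) N).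
    rewrite /product_measure2; apply: eq_integral => x _.
    by rewrite gee0_abs//= measure_ge0.
  by apply/esym/product_measure_unique => // A B mA mB; rewrite /= product_measure2E.
move=> /(_ erefl); apply: filterS => x /(_ I) xN0.
exists (ysection N x); split => //; first exact: measurable_ysection.
by move=> y /= nP; rewrite /ysection /= inE; exact: PN.
Qed.

End product_sections.

(** * Almost everywhere equality under a complete measure *)

Section complete_measure.
Context {R : realType} {d : measure_display} {T : measurableType d}.
Variable mu : {measure set T -> \bar R}.
Hypothesis cmu : measure_is_complete mu.

(** Off a null set [N] the two sets coincide, and the part of [B] inside [N] is measurable by
    completeness. *)
Lemma ae_measurable_set (A B : set T) : measurable A ->
  {ae mu, forall x, A x <-> B x} -> measurable B.
Proof.
move=> mA [N [mN N0 ABN]].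
have -> : B = (A `\` N) `|` (B `&` N).
  apply/seteqP; split=> [x Bx|x [[Ax nNx]|[]//]].
    have [Nx|nNx] := pselect (N x); [by right|left; split => //].
    apply: contrapT => nAx; apply: nNx; apply: ABN => /= -[_ /(_ Bx)].
    exact: nAx.
  by apply: contrapT => nBx; apply: nNx; apply: ABN => /= -[/(_ Ax)].
apply: measurableU; first exact: measurableD.
by apply: cmu; exists N; split.
Qed.

(** Completeness carries measurability from [f] to [g]. This is how integrands containing gamma are
    exchanged for measurable ones. *)
Lemma ae_eq_integral_complete (D : set T) (f g : T -> \bar R) :
  measurable D -> measurable_fun D f -> {ae mu, forall x, D x -> f x = g x} ->
  \int[mu]_(x in D) f x = \int[mu]_(x in D) g x.
Proof.
move=> mD mf fg; apply: ae_eq_integral => //.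
exact: (ae_measurable_fun cmu fg).
Qed.

End complete_measure.

(** * Completeness of Lebesgue measure and measurability of open sets *)

Section Rd_measure.
Variables (R : realType) (d : nat).

Lemma leb_complete : measure_is_complete (@leb R d).
Proof. exact: measure_is_complete_caratheodory. Qed.

(** An open set is the union of the countably many boxes with rational centre and radius that it
    contains. *)
Lemma open_measurable_rV (A : set 'rV[R]_d) :
  open A -> measurable (A : set 'rV[measurableTypeR R]_d).
Proof.
move=> oA.
pose box (p : 'rV[rat]_d * rat) : set 'rV[measurableTypeR R]_d :=
  [set v : 'rV[R]_d | forall i, (`|ratr (p.1 ord0 i) - v ord0 i| < ratr p.2)%R].
have mbox p : measurable (box p).
  have -> : box p = \bigcap_(i in [set: 'I_d])
      (@rV_coord _ (measurableTypeR R) d i @^-1`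
        `](ratr (p.1 ord0 i) - ratr p.2)%R, (ratr (p.1 ord0 i) + ratr p.2)%R[%classic).
    apply/seteqP; split => v /= vp i => [_|].
      by move: (vp i); rewrite /= in_itv/= /rV_coord ltr_distlC.
    by move: (vp i I); rewrite /= in_itv/= /rV_coord ltr_distlC.
  apply: fin_bigcap_measurable => // i _.
  rewrite -[X in measurable X]setTI.
  apply: (@measurable_rV_coord _ (measurableTypeR R) d i) => //.
have -> : A = \bigcup_(p : 'rV[rat]_d * rat)
    (if pselect (box p `<=` A) then box p else set0).
  apply/seteqP; split => [v Av|v [p _]]; last by case: pselect => //; apply.
  have [e /= e0 veA] : exists2 e : R, (0 < e)%R & ball v e `<=` A.
    by have /nbhs_ballP[e] := open_nbhs_nbhs (conj oA Av); exists e.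
  (* The radius stays below [e / 2]: the centre is within [r] of [v], and the box within [r] of the
     centre. *)
  have [r] := rat_in_itvoo (divr_gt0 e0 (ltr0Sn R 1)).
  rewrite in_itv/= => /andP[r0 re].
  have [c cP] : {c : 'I_d -> rat & forall i, (`|ratr (c i) - v ord0 i| < ratr r)%R}.
    apply: (@choice _ _ (fun i q => (`|ratr q - v ord0 i| < ratr r)%R)) => i.
    have vr : (v ord0 i - ratr r < v ord0 i + ratr r)%R.
      by rewrite ltrBlDr -addrA ltrDl addr_gt0.
    have [q] := rat_in_itvoo vr.
    by rewrite in_itv/= -ltr_distlC distrC; exists q.
  exists (\row_i c i, r) => //; case: pselect => [_ i|]; first by rewrite mxE.
  case=> w /= wc; apply: veA; split => // i j; rewrite !ord1.
  have := wc j; have := cP j; rewrite mxE /ball/= => cv cw.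
  rewrite (le_lt_trans (ler_distD (ratr (c j)) _ _))//.
  by rewrite (splitr e) ltrD// ?(lt_trans cw)// distrC (lt_trans cv).
apply: countable_bigcupT_measurable => [|p]; first exact: countableP.
by case: (pselect (box p `<=` A)) => ?; [exact: mbox|exact: measurable0].
Qed.

Lemma open_measurable_Rd (A : set (Rd R d)) : open A -> measurable A.
Proof.
move=> oA; apply: (@caratheodory_measurable_mu_ext _ _ _ (borel_lebesgue R d)).
exact: open_measurable_rV.
Qed.

End Rd_measure.

(** * Iterated integrals *)

Section integral_tools.
Context {R : realType} {d : measure_display} {T : measurableType d}.
Variable mu : {measure set T -> \bar R}.

Lemma ae_and (P Q : T -> Prop) : {ae mu, forall x, P x} ->
  {ae mu, forall x, Q x} -> {ae mu, forall x, P x /\ Q x}.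
Proof. by apply: filterS2 => x. Qed.

(* No integrability is needed: [c * +oo] is what both sides give. *)
Lemma ge0_integralZl_real (D : set T) (f : T -> \bar R) (c : R) :
  measurable D -> measurable_fun D f -> (forall x, D x -> 0 <= f x) ->
  \int[mu]_(x in D) (c%:E * f x) = c%:E * \int[mu]_(x in D) f x.
Proof.
move=> mD mf f0; have [c0|c0] := leP 0%R c; first exact: ge0_integralZl_EFin.
have -> : c = (- - c)%R by rewrite opprK.
rewrite EFinN mulNe -ge0_integralZl_EFin// ?oppr_ge0 ?ltW//.
rewrite -integral_ge0N; last first.
  by move=> x Dx; rewrite mule_ge0 ?f0// lee_fin oppr_ge0 ltW.
by apply: eq_integral => x _; rewrite mulNe.
Qed.

Lemma ge0_integral_lty_ae (D : set T) (f : T -> \bar R) :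
  measurable D -> measurable_fun D f -> (forall x, D x -> 0 <= f x) ->
  \int[mu]_(x in D) f x < +oo -> {ae mu, forall x, D x -> f x < +oo}.
Proof.
move=> mD mf f0 foo; have : mu.-integrable D f.
  apply/integrableP; split => //; apply: le_lt_trans foo.
  rewrite le_eqVlt; apply/orP; left; apply/eqP; apply: eq_integral => x /[!inE] Dx.
  by rewrite gee0_abs// f0.
move=> /integrable_ae-/(_ mD); apply: filterS => x fx Dx.
by rewrite -ge0_fin_numE ?f0//; exact: fx.
Qed.

End integral_tools.

Section tonelli_on_rectangles.
Context {R : realType} {d1 d2 : measure_display}.
Context {T1 : measurableType d1} {T2 : measurableType d2}.
Variables (m1 : {sigma_finite_measure set T1 -> \bar R}).
Variables (m2 : {sigma_finite_measure set T2 -> \bar R}).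
Variables (A : set T1) (B : set T2) (mA : measurable A) (mB : measurable B).
Implicit Type f : T1 * T2 -> \bar R.

(** Restricting the integrand to the rectangle turns integrals over [A] and [B] into integrals over
    the whole spaces, to which Tonelli and Fubini apply. *)
Let restrict1 f x :
  ((fun x => \int[m2]_(y in B) f (x, y)) \_ A) x =
  \int[m2]_y (f \_ (A `*` B)) (x, y).
Proof.
rewrite patchE; case: ifPn => xA; last first.
  rewrite integral0_eq// => y _; rewrite patchE ifF//; apply/negbTE.
  by move: xA; rewrite !notin_setE; apply: contra_not => -[].
rewrite integral_mkcond; apply: eq_integral => y _; rewrite !patchE.
congr (if _ then _ else _); rewrite in_setX xA.
by [].
Qed.

Let restrict2 f y :
  ((fun y => \int[m1]_(x in A) f (x, y)) \_ B) y =
  \int[m1]_x (f \_ (A `*` B)) (x, y).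
Proof.
rewrite patchE; case: ifPn => yB; last first.
  rewrite integral0_eq// => x _; rewrite patchE ifF//; apply/negbTE.
  by move: yB; rewrite !notin_setE; apply: contra_not => -[].
rewrite integral_mkcond; apply: eq_integral => x _; rewrite !patchE.
by congr (if _ then _ else _); rewrite in_setX yB andbT.
Qed.

Let measurable_restrictX f : measurable_fun setT f ->
  measurable_fun setT (f \_ (A `*` B)).
Proof.
move=> mf; apply/(measurable_restrictT _ _).1; first exact: measurableX.
exact: measurable_funTS.
Qed.

Lemma ge0_integral_setX_swap f : measurable_fun setT f -> (forall p, 0 <= f p) ->
  \int[m1]_(x in A) \int[m2]_(y in B) f (x, y) =
  \int[m2]_(y in B) \int[m1]_(x in A) f (x, y).
Proof.
move=> mf f0; rewrite integral_mkcond [RHS]integral_mkcond.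
under eq_integral do rewrite restrict1.
under [RHS]eq_integral do rewrite restrict2.
apply: fubini_tonelli; first exact: measurable_restrictX.
by move=> p; apply: erestrict_ge0.
Qed.

Lemma integral_setX_swap f : measurable_fun setT f ->
  \int[m1]_(x in A) \int[m2]_(y in B) `|f (x, y)| < +oo ->
  \int[m1]_(x in A) \int[m2]_(y in B) f (x, y) =
  \int[m2]_(y in B) \int[m1]_(x in A) f (x, y).
Proof.
move=> mf foo; rewrite integral_mkcond [RHS]integral_mkcond.
under eq_integral do rewrite restrict1.
under [RHS]eq_integral do rewrite restrict2.
apply: Fubini; apply/integrable12ltyP; first exact: measurable_restrictX.
apply: le_lt_trans foo; rewrite le_eqVlt; apply/orP; left; apply/eqP.
rewrite [RHS]integral_mkcond.
apply: eq_integral => x _; rewrite (restrict1 (abse \o f)).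
by apply: eq_integral => y _; rewrite !patchE; case: ifP => //; rewrite abse0.
Qed.

(** No sign or integrability is assumed: the integral is by definition the difference of those of
    the positive and negative parts, and Tonelli covers each. *)
Lemma measurable_fun_integral1 f : measurable_fun setT f ->
  measurable_fun setT (fun x => \int[m2]_(y in B) f (x, y)).
Proof.
move=> mf.
have h (g : T1 * T2 -> \bar R) : (forall p, 0 <= g p) -> measurable_fun setT g ->
    measurable_fun setT (fun x => \int[m2]_(y in B) g (x, y)).
  move=> g0 mg; rewrite (_ : (fun x => _) =
      fubini_F m2 (g \_ ([set: T1] `*` B))).
    apply: measurable_fun_fubini_tonelli_F => [|p]; last exact: erestrict_ge0.
    apply/(measurable_restrictT _ _).1; first exact: measurableX.
    exact: measurable_funTS.
  apply/funext => x; rewrite /fubini_F [LHS]integral_mkcond.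
  apply: eq_integral => y _; rewrite !patchE.
  by congr (if _ then _ else _); rewrite in_setX in_setT.
rewrite (_ : (fun x => _) = (fun x => \int[m2]_(y in B) f^\+ (x, y)) \-
    (fun x => \int[m2]_(y in B) f^\- (x, y))).
  by apply: emeasurable_funB; apply: h => //;
    [exact: measurable_funepos|exact: measurable_funeneg].
apply/funext => x; rewrite integralE/=; congr (_ - _); apply: eq_integral => y _.
  by rewrite funepos_comp.
by rewrite funeneg_comp.
Qed.

End tonelli_on_rectangles.

Lemma measurable_fun_integral2 {R : realType} {d1 d2 : measure_display}
    {T1 : measurableType d1} {T2 : measurableType d2}
    (m1 : {sigma_finite_measure set T1 -> \bar R}) (A : set T1)
    (f : T1 * T2 -> \bar R) : measurable A -> measurable_fun setT f ->
  measurable_fun setT (fun y => \int[m1]_(x in A) f (x, y)).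
Proof.
move=> mA mf.
apply: (measurable_fun_integral1 m1 mA (f := f \o @unstable.swap _ _)).
by apply: measurableT_comp => //; exact: measurable_swap.
Qed.

(** * Elimination of the boundary values *)

Section robin_substitution.
Context {R : realType} {disp : measure_display} {T : measurableType disp}.
Variable mu : {sigma_finite_measure set T -> \bar R}.
Variables (Om Ga : set T) (ga : T * T -> R) (u g p q r : T -> R).
Hypotheses (mOm : measurable Om) (mGa : measurable Ga).
Hypothesis ga0 : forall w, (0 <= ga w)%R.
Hypothesis mga : measurable_fun setT ga.
Hypotheses (meas_u : measurable_fun setT u) (meas_g : measurable_fun setT g).
Hypotheses (mp : measurable_fun setT p) (mq : measurable_fun setT q).
Hypothesis mr : measurable_fun setT r.
Hypotheses (p0 : forall y, (0 <= p y)%R) (q0 : forall y, (0 <= q y)%R).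
Hypothesis r0 : forall y, (0 <= r y)%R.

(** Called k in the overview, with [ga] in place of gamma; [inflow] is V there. *)
Definition exit_rate y : \bar R := \int[mu]_(v in Om) (ga (y, v))%:E.
(* The difference between [gamma_alpha] and [gamma] *)
Definition reflected_rate x z : \bar R :=
  \int[mu]_(y in Ga) (p y * ga (x, y) * ga (y, z))%:E.
Definition inflow y : \bar R := \int[mu]_(z in Om) (u z * ga (z, y))%:E.
Definition abs_inflow y : \bar R := \int[mu]_(z in Om) `|u z * ga (z, y)|%:E.

Let mga1 x : measurable_fun setT (fun y => ga (x, y)).
Proof. exact: measurable_fun_pair2. Qed.

Let mga2 y : measurable_fun setT (fun x => ga (x, y)).
Proof. exact: measurable_fun_pair1. Qed.

Let mgaC : measurable_fun setT (fun w : T * T => ga (w.2, w.1)).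
Proof. by apply: (measurableT_comp mga); exact: measurable_swap. Qed.

Let mfst (f : T -> R) : measurable_fun setT f ->
  measurable_fun setT (fun w : T * T => f w.1).
Proof. by move=> mf; exact: measurableT_comp. Qed.

Let msnd (f : T -> R) : measurable_fun setT f ->
  measurable_fun setT (fun w : T * T => f w.2).
Proof. by move=> mf; exact: measurableT_comp. Qed.

Ltac meas := repeat first
  [ assumption | exact: mga1 | exact: mga2 | exact: mgaC
  | apply: measurable_funM | apply: measurable_funB | apply: measurable_funD
  | exact: measurable_cst
  | apply: mfst | apply: msnd
  | exact: (mfst (mga1 _)) | exact: (msnd (mga1 _))
  | exact: (mfst (mga2 _)) | exact: (msnd (mga2 _)) ].

(** Tonelli, with the weight leaving the inner integral. It produces the factor [exit_rate], which
    later bounds such as [p k <= 1] and [r k <= 2] absorb. *)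
Lemma integral_weight_swap (w : T -> \bar R) (D : set T) : measurable D ->
  measurable_fun setT w -> (forall y, 0 <= w y) ->
  \int[mu]_(x in Om) \int[mu]_(y in D) (w y * (ga (y, x))%:E) =
  \int[mu]_(y in D) (w y * exit_rate y).
Proof.
move=> mD mw w0.
rewrite (ge0_integral_setX_swap mu mu mOm mD (f := fun s => w s.2 * (ga (s.2, s.1))%:E)).
- apply: eq_integral => y _ /=; rewrite ge0_integralZl//.
  + by apply/measurable_EFinP; exact: measurable_funTS.
  + by move=> x _; rewrite lee_fin.
- apply: emeasurable_funM; first exact: measurableT_comp.
  by apply/measurable_EFinP; meas.
- by move=> s; rewrite mule_ge0// lee_fin.
Qed.

(** With weight 1, Tonelli makes the double integral of [ga] vanish, and a nonnegative function with
    zero integral is zero almost everywhere. Applied to [ga] and to its transpose, this disposes of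
    the points outside the boundary sets. *)
Lemma exit_rate_eq0_ae (D : set T) : measurable D ->
  {ae mu, forall y, D y -> exit_rate y = 0} ->
  {ae mu, forall x, Om x -> {ae mu, forall y, D y -> ga (y, x) = 0%R}}.
Proof.
move=> mD k0.
pose F x := \int[mu]_(y in D) (cst 1 y * (ga (y, x))%:E).
have F0 x : 0 <= F x.
  by apply: integral_ge0 => y _; rewrite /= mul1e lee_fin.
have mF : measurable_fun Om F.
  apply: measurable_funTS.
  apply: (measurable_fun_integral1 mu mD (f := fun w => cst 1 w.2 * (ga (w.2, w.1))%:E)).
  by apply: emeasurable_funM => //; apply/measurable_EFinP; meas.
have intF : \int[mu]_(x in Om) `|F x| = 0.
  under eq_integral do rewrite gee0_abs//.
  rewrite /F integral_weight_swap//.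
  transitivity (\int[mu]_(y in D) cst 0 y); last exact: integral0.
  apply: ae_eq_integral => //.
    apply: measurable_funTS; apply: emeasurable_funM => //.
    by apply: (measurable_fun_integral1 mu mOm (f := EFin \o ga)); exact/measurable_EFinP.
  by apply: filterS k0 => y + Dy => /(_ Dy) ->; rewrite mule0.
have /(ae_eq_integral_abs mu mOm mF).1 := intF.
apply: filterS => x + Ox => /(_ Ox) Fx0.
have mgax : measurable_fun D (fun y => (ga (y, x))%:E).
  by apply/measurable_EFinP/measurable_funTS; meas.
have [+ _] := ae_eq_integral_abs mu mD mgax.
have -> : \int[mu]_(y in D) `|(ga (y, x))%:E| = 0.
  by rewrite -[RHS]Fx0; apply: eq_integral => y _; rewrite /= mul1e ger0_norm.
move=> /(_ erefl); apply: filterS => y gayx Dy.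
by case: (gayx Dy).
Qed.

Lemma exit_rate_ge0 y : 0 <= exit_rate y.
Proof. by apply: integral_ge0 => v _; rewrite lee_fin. Qed.

Lemma measurable_exit_rate : measurable_fun setT exit_rate.
Proof.
by apply: (measurable_fun_integral1 mu mOm (f := EFin \o ga)); exact/measurable_EFinP.
Qed.

Lemma reflected_rate_ge0 x z : 0 <= reflected_rate x z.
Proof. by apply: integral_ge0 => v _; rewrite lee_fin !mulr_ge0. Qed.

Lemma measurable_reflected_rate1 x : measurable_fun setT (reflected_rate x).
Proof.
apply: (measurable_fun_integral2 mu
  (f := fun w => (p w.1 * ga (x, w.1) * ga w)%:E)) => //.
by apply/measurable_EFinP; apply: measurable_funM => //; meas.
Qed.

Lemma measurable_reflected_rate2 x : measurable_fun setT (reflected_rate ^~ x).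
Proof.
apply: (measurable_fun_integral1 mu mGa (f := fun w => (p w.2 * ga w * ga (w.2, x))%:E)).
by apply/measurable_EFinP; meas.
Qed.

Lemma abs_inflow_ge0 y : 0 <= abs_inflow y.
Proof. by apply: integral_ge0 => v _; rewrite lee_fin. Qed.

Lemma measurable_abs_inflow : measurable_fun setT abs_inflow.
Proof.
apply: (measurable_fun_integral2 mu (f := fun w => `|u w.1 * ga w|%:E)) => //.
by apply/measurable_EFinP; apply: measurableT_comp => //; meas.
Qed.

Lemma measurable_inflow : measurable_fun setT inflow.
Proof.
apply: (measurable_fun_integral2 mu (f := fun w => (u w.1 * ga w)%:E)) => //.
by apply/measurable_EFinP; meas.
Qed.

Lemma abse_inflow_le y : `|inflow y| <= abs_inflow y.
Proof.
by apply: le_abse_integral => //; apply/measurable_EFinP/measurable_funTS; meas.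
Qed.

(** * Outgoing part on the boundary: reflected and killed mass *)

Hypothesis pkq1 : {ae mu, forall y, Ga y -> (p y)%:E * exit_rate y + (q y)%:E = 1}.

Lemma pk_le1 : {ae mu, forall y, Ga y -> (p y)%:E * exit_rate y <= 1}.
Proof. by apply: filterS pkq1 => y + Gy => /(_ Gy) <-; rewrite leeDl// lee_fin. Qed.

(** The integrand is multiplied by [p k + q = 1], and Tonelli recognizes the [p k] part as the total
    reflected rate. All terms are nonnegative, so infinite values are allowed. *)
Lemma integral_escape_split x :
  \int[mu]_(y in Ga) (ga (x, y))%:E =
  \int[mu]_(z in Om) reflected_rate x z + \int[mu]_(y in Ga) (q y * ga (x, y))%:E.
Proof.
have -> : \int[mu]_(z in Om) reflected_rate x z =
    \int[mu]_(y in Ga) ((p y * ga (x, y))%:E * exit_rate y).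
  rewrite -(integral_weight_swap mGa (w := fun y => (p y * ga (x, y))%:E)) //.
  - by apply/measurable_EFinP; meas.
  - by move=> y; rewrite lee_fin mulr_ge0.
have mqga : measurable_fun setT (fun y => (q y * ga (x, y))%:E).
  by apply/measurable_EFinP; meas.
have mpk : measurable_fun setT (fun y => (p y * ga (x, y))%:E * exit_rate y).
  apply: emeasurable_funM; last exact: measurable_exit_rate.
  by apply/measurable_EFinP; meas.
have mgax : measurable_fun setT (fun y => (ga (x, y))%:E).
  by apply/measurable_EFinP; meas.
have pk0 y : 0 <= (p y * ga (x, y))%:E * exit_rate y.
  by rewrite mule_ge0 ?exit_rate_ge0// lee_fin mulr_ge0.
have q0' y : 0 <= (q y * ga (x, y))%:E by rewrite lee_fin mulr_ge0.
rewrite -ge0_integralD//; [|exact: measurable_funTS..].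
apply: ge0_ae_eq_integral => //.
- exact: measurable_funTS.
- by apply: emeasurable_funD; exact: measurable_funTS.
- by move=> y _; rewrite lee_fin.
- by move=> y _; rewrite adde_ge0.
apply: filterS pkq1 => y + Gy => /(_ Gy) pkq.
rewrite -[LHS]mul1e -pkq ge0_muleDl ?mule_ge0 ?exit_rate_ge0 ?lee_fin//.
by rewrite !EFinM muleAC.
Qed.

(** * Integrability of the source term *)

Hypothesis rk : {ae mu, forall y, Ga y -> (r y <= 2)%R \/ (r y)%:E * exit_rate y <= 2%:E}.
Hypothesis ga_bounded : {ae mu, forall x, Om x ->
  exists C : R, {ae mu, forall y, Ga y -> (ga (y, x) <= C)%R}}.
Hypothesis g_int : mu.-integrable Ga (EFin \o g).

Lemma integrable_source : {ae mu, forall x, Om x ->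
  mu.-integrable Ga (fun y => (g y * ga (y, x) * r y)%:E)}.
Proof.
pose G1 := Ga `&` [set y | (r y <= 2)%R]; pose G2 := Ga `\` [set y | (r y <= 2)%R].
have mr2 : measurable [set y | (r y <= 2)%R].
  have := mr measurableT (measurable_itv `]-oo, 2%R]); rewrite setTI.
  by congr measurable; apply/seteqP; split => y /=; rewrite in_itv.
have mG1 : measurable G1 by exact: measurableI.
have mG2 : measurable G2 by exact: measurableD.
have mgr : measurable_fun setT (fun y => (`|g y| * r y)%:E).
  by apply/measurable_EFinP/measurable_funM => //; exact: measurableT_comp.
have mgxr x : measurable_fun setT (fun y => (g y * ga (y, x) * r y)%:E).
  by apply/measurable_EFinP; meas.
have mgxr' x : measurable_fun setT (fun y => `|(g y * ga (y, x) * r y)%:E|).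
  exact: measurableT_comp.
have gfin : \int[mu]_(y in Ga) `|(g y)%:E| < +oo by case/integrableP : g_int.
(* On [G2] the second alternative of [rk] holds; integrating in [x] first turns the weight [r] into
   [r k], which is at most 2. *)
have int2 : \int[mu]_(x in Om) \int[mu]_(y in G2)
    ((`|g y| * r y)%:E * (ga (y, x))%:E) < +oo.
  rewrite integral_weight_swap//; last by move=> y; rewrite lee_fin mulr_ge0.
  apply: (@le_lt_trans _ _ (\int[mu]_(y in G2) (2%:E * `|(g y)%:E|))).
    apply: ae_ge0_le_integral => //.
    - by move=> y _; rewrite mule_ge0 ?exit_rate_ge0// lee_fin mulr_ge0.
    - apply: measurable_funTS; apply: emeasurable_funM => //.
      exact: measurable_exit_rate.
    - apply: measurable_funTS; apply: measurable_funeM.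
      by apply: measurableT_comp => //; exact/measurable_EFinP.
    apply: filterS rk => y + [Gy /= r2] => /(_ Gy)[//|rky].
    by rewrite EFinM -muleA muleC lee_wpmul2r// lee_fin.
  rewrite ge0_integralZl//; last first.
    apply: measurable_funTS.
    by apply: measurableT_comp => //; exact/measurable_EFinP.
  rewrite lte_mul_pinfty//; apply: le_lt_trans gfin.
  apply: ge0_subset_integral => //; last by move=> y [].
  by apply: measurable_funTS; apply: measurableT_comp => //; exact/measurable_EFinP.
have : {ae mu, forall x, Om x ->
    \int[mu]_(y in G2) ((`|g y| * r y)%:E * (ga (y, x))%:E) < +oo}.
  apply: ge0_integral_lty_ae int2 => //.
    apply: measurable_funTS.
    apply: (measurable_fun_integral1 mu mG2
      (f := fun w => (`|g w.2| * r w.2)%:E * (ga (w.2, w.1))%:E)).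
    apply: emeasurable_funM; first exact: (measurableT_comp mgr).
    by apply/measurable_EFinP; meas.
  by move=> x _; apply: integral_ge0 => y _; rewrite mule_ge0// lee_fin// mulr_ge0.
apply: filterS2 ga_bounded => x + + Ox => /(_ Ox)[C gaC] /(_ Ox) int2x.
apply/integrableP; split; first exact: measurable_funTS.
have -> : Ga = G1 `|` G2 by rewrite /G1 /G2 setUIDK.
rewrite ge0_integral_setU//; first last.
- by apply/disj_setPS => y [[_ ?] []].
- exact: measurable_funTS.
rewrite lte_add_pinfty//; last first.
  apply: le_lt_trans int2x; rewrite le_eqVlt; apply/orP; left; apply/eqP.
  apply: eq_integral => y _.
  by rewrite -EFinM/= !normrM (ger0_norm (ga0 _)) (ger0_norm (r0 _)) mulrAC.
(* On [G1] the factors are bounded by 2 and [C]; the absolute value keeps the constant nonnegative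
   whatever the sign of [C]. *)
apply: (@le_lt_trans _ _ (\int[mu]_(y in G1) ((2 * `|C|)%:E * `|(g y)%:E|))).
  apply: ae_ge0_le_integral => //.
  - exact: measurable_funTS.
  - apply: measurable_funTS; apply: measurable_funeM.
    by apply: measurableT_comp => //; exact/measurable_EFinP.
  apply: filterS gaC => y + [Gy /= r2] => /(_ Gy) gaCy.
  rewrite -EFinM lee_fin !normrM (ger0_norm (ga0 _)) (ger0_norm (r0 _)).
  rewrite -mulrA mulrC ler_wpM2r// mulrC ler_pM//.
  exact: (le_trans gaCy (ler_norm _)).
rewrite ge0_integralZl ?lee_fin ?mulr_ge0//; last first.
  apply: measurable_funTS.
  by apply: measurableT_comp => //; exact/measurable_EFinP.
rewrite lte_mul_pinfty// ?lee_fin ?mulr_ge0//; apply: le_lt_trans gfin.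
apply: ge0_subset_integral => //; last by move=> y [].
by apply: measurable_funTS; apply: measurableT_comp => //; exact/measurable_EFinP.
Qed.

(** * Absolute flux, h in the overview, and the bounds that follow from it *)

Definition abs_flux y : \bar R :=
  \int[mu]_(z in Om) `|u z * ga (z, y) - u y * ga (y, z)|%:E.

Hypothesis flux_int :
  \int[mu]_(x in Om) \int[mu]_y `|u x * ga (x, y) - u y * ga (y, x)|%:E < +oo.

Let mflux : measurable_fun setT
  (fun w : T * T => `|u w.1 * ga w - u w.2 * ga (w.2, w.1)|%:E).
Proof.
apply/measurable_EFinP; apply: measurableT_comp => //.
by apply: measurable_funB; apply: measurable_funM => //; meas.
Qed.

Let mflux2 y : measurable_fun setT
  (fun z => `|u z * ga (z, y) - u y * ga (y, z)|%:E).
Proof. by apply/measurable_EFinP; apply: measurableT_comp => //; meas. Qed.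

Let abs_flux_ge0 y : 0 <= abs_flux y.
Proof. by apply: integral_ge0 => z _; rewrite lee_fin. Qed.

Let measurable_abs_flux : measurable_fun setT abs_flux.
Proof.
exact: (measurable_fun_integral2 mu
  (f := fun w => `|u w.1 * ga w - u w.2 * ga (w.2, w.1)|%:E)).
Qed.

(** Tonelli turns this into the flux hypothesis with the inner integral cut down to [Ga]. *)
Let abs_flux_lty : \int[mu]_(y in Ga) abs_flux y < +oo.
Proof.
rewrite /abs_flux -(ge0_integral_setX_swap mu mu mOm mGa
  (f := fun w => `|u w.1 * ga w - u w.2 * ga (w.2, w.1)|%:E))//.
apply: le_lt_trans flux_int; apply: ge0_le_integral => //.
- by move=> x _; apply: integral_ge0 => y _; rewrite lee_fin.
- apply: measurable_funTS.
  exact: (measurable_fun_integral1 mu mGa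
    (f := fun w => `|u w.1 * ga w - u w.2 * ga (w.2, w.1)|%:E)).
- apply: measurable_funTS.
  exact: (measurable_fun_integral1 mu measurableT
    (f := fun w => `|u w.1 * ga w - u w.2 * ga (w.2, w.1)|%:E)).
- move=> x Ox; apply: ge0_subset_integral => //.
  by apply: (measurableT_comp mflux); exact: pair1_measurable.
Qed.

(** Triangle inequality after adding and subtracting [u y * ga (y, z)]. *)
Let abs_inflow_le y : abs_inflow y <= abs_flux y + `|u y|%:E * exit_rate y.
Proof.
rewrite /abs_flux /exit_rate -ge0_integralZl//; last 2 first.
- by apply/measurable_EFinP; exact: measurable_funTS.
- by move=> z _; rewrite lee_fin.
rewrite -ge0_integralD//; first last.
- by apply: measurable_funTS; apply: measurable_funeM; exact/measurable_EFinP.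
- by move=> z _; rewrite mule_ge0// lee_fin.
- exact: measurable_funTS.
apply: ge0_le_integral => //.
- by apply: measurable_funTS; apply/measurable_EFinP; apply: measurableT_comp => //; meas.
- apply: measurable_funTS; apply: emeasurable_funD.
    exact: measurable_funTS.
  by apply: measurable_funeM; exact/measurable_EFinP.
move=> z _; rewrite -EFinM -EFinD lee_fin.
rewrite -[X in (_ + _ * X)%R](ger0_norm (ga0 _)) -normrM.
by rewrite (le_trans _ (ler_normD _ _))// subrK.
Qed.

Hypothesis escape_int : {ae mu, forall x, Om x ->
  \int[mu]_(y in Ga) (ga (x, y))%:E < +oo}.

Let integrable_flux x : \int[mu]_y `|u x * ga (x, y) - u y * ga (y, x)|%:E < +oo ->
  mu.-integrable setT (fun y => (u x * ga (x, y) - u y * ga (y, x))%:E).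
Proof. by move=> foo; apply/integrableP; split => //; apply/measurable_EFinP; meas. Qed.

Let ae_flux : {ae mu, forall x, Om x ->
  mu.-integrable setT (fun y => (u x * ga (x, y) - u y * ga (y, x))%:E)}.
Proof.
have := ge0_integral_lty_ae mOm _ _ flux_int.
case=> [|x _|N [mN N0 PN]].
- apply: measurable_funTS.
  exact: (measurable_fun_integral1 mu measurableT
    (f := fun w => `|u w.1 * ga w - u w.2 * ga (w.2, w.1)|%:E)).
- by apply: integral_ge0 => y _; rewrite lee_fin.
exists N; split => // x /= nx; apply: PN => /= Px; apply: nx => Ox.
exact: integrable_flux (Px Ox).
Qed.

Let integrable_escape x : \int[mu]_(y in Ga) (ga (x, y))%:E < +oo ->
  mu.-integrable Ga (fun y => (u x * ga (x, y))%:E).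
Proof.
move=> foo; have : mu.-integrable Ga (fun y => (ga (x, y))%:E).
  apply/integrableP; split; first by apply/measurable_EFinP/measurable_funTS.
  by under eq_integral do rewrite gee0_abs ?lee_fin//.
by move=> /(integrableZl mGa (u x)); under eq_fun do rewrite -EFinM.
Qed.

(** The returning term is the outgoing term minus the flux, and both of these are integrable on
    [Ga]. *)
Let ae_return : {ae mu, forall x, Om x ->
  mu.-integrable Ga (fun y => (u y * ga (y, x))%:E)}.
Proof.
apply: filterS2 escape_int ae_flux => x ex fx Ox.
have ie := integrable_escape (ex Ox).
have := integrableB mGa ie (integrableS measurableT mGa (@subsetT _ _) (fx Ox)).
apply: eq_integrable => // y _ /=; rewrite -EFinB; congr EFin.
by rewrite opprB addrC subrK.
Qed.

(** [abs_inflow_le] leaves two terms: [p h] against [ga (y, x)], finite for almost every [x] by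
    Tonelli and [pk_le1], and [p k] times the integrand of [ae_return]. *)
Lemma return_weight_finite : {ae mu, forall x, Om x ->
  \int[mu]_(y in Ga) ((p y * ga (y, x))%:E * abs_inflow y) < +oo}.
Proof.
have mph : measurable_fun setT (fun y => (p y)%:E * abs_flux y).
  by apply: emeasurable_funM => //; exact/measurable_EFinP.
have ph0 y : 0 <= (p y)%:E * abs_flux y by rewrite mule_ge0// lee_fin.
have int_ph : \int[mu]_(x in Om) \int[mu]_(y in Ga)
    ((p y)%:E * abs_flux y * (ga (y, x))%:E) < +oo.
  rewrite integral_weight_swap//; apply: le_lt_trans abs_flux_lty.
  apply: ae_ge0_le_integral => //.
  - by move=> y _; rewrite mule_ge0 ?exit_rate_ge0.
  - apply: measurable_funTS; apply: emeasurable_funM => //.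
    exact: measurable_exit_rate.
  - exact: measurable_funTS.
  apply: filterS pk_le1 => y + Gy => /(_ Gy) pk1.
  by rewrite muleAC -[leRHS]mul1e lee_wpmul2r.
have : {ae mu, forall x, Om x ->
    \int[mu]_(y in Ga) ((p y)%:E * abs_flux y * (ga (y, x))%:E) < +oo}.
  apply: ge0_integral_lty_ae int_ph => //.
    apply: measurable_funTS.
    apply: (measurable_fun_integral1 mu mGa
      (f := fun w => (p w.2)%:E * abs_flux w.2 * (ga (w.2, w.1))%:E)).
    apply: emeasurable_funM; first exact: (measurableT_comp mph).
    by apply/measurable_EFinP; meas.
  by move=> x _; apply: integral_ge0 => y _; rewrite mule_ge0// lee_fin.
apply: filterS2 ae_return => x + + Ox => /(_ Ox)/integrableP[mret ret] /(_ Ox) phx.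
have mphg : measurable_fun setT (fun y => (p y)%:E * abs_flux y * (ga (y, x))%:E).
  by apply: emeasurable_funM => //; exact/measurable_EFinP.
have mpU : measurable_fun setT (fun y => (p y * ga (y, x))%:E * abs_inflow y).
  apply: emeasurable_funM; last exact: measurable_abs_inflow.
  by apply/measurable_EFinP; meas.
have aret : measurable_fun Ga (fun y => `|(u y * ga (y, x))%:E|).
  exact: measurableT_comp mret.
apply: (@le_lt_trans _ _ (\int[mu]_(y in Ga) ((p y)%:E * abs_flux y * (ga (y, x))%:E +
    `|(u y * ga (y, x))%:E|))); last first.
  have phg0 y : 0 <= (p y)%:E * abs_flux y * (ga (y, x))%:E by rewrite mule_ge0// lee_fin.
  rewrite ge0_integralD//; last exact: measurable_funTS.
  exact: lte_add_pinfty.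
apply: ae_ge0_le_integral => //.
- by move=> y _; rewrite mule_ge0 ?abs_inflow_ge0// lee_fin mulr_ge0.
- exact: measurable_funTS.
- by move=> y _; rewrite adde_ge0// mule_ge0// lee_fin.
- by apply: emeasurable_funD => //; exact: measurable_funTS.
apply: filterS pk_le1 => y + Gy => /(_ Gy) pk1.
apply: (@le_trans _ _ ((p y * ga (y, x))%:E * (abs_flux y + `|u y|%:E * exit_rate y))).
  by rewrite lee_wpmul2l// lee_fin mulr_ge0.
rewrite ge0_muleDr ?mule_ge0 ?exit_rate_ge0//; apply: leeD.
  by rewrite EFinM muleAC.
have -> : (p y * ga (y, x))%:E * (`|u y|%:E * exit_rate y) =
    ((p y)%:E * exit_rate y) * `|(u y * ga (y, x))%:E|.
  rewrite /= normrM (ger0_norm (ga0 _)) !EFinM.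
  by rewrite [X in _ * X = _]muleC muleACA [X in _ * X = _]muleC.
by rewrite -[leRHS]mul1e lee_wpmul2r.
Qed.

(** * Insertion of the boundary values into the incoming part *)

Hypothesis exit_rate_lty : {ae mu, forall y, Ga y -> exit_rate y < +oo}.
Let abs_inflow_lty : {ae mu, forall y, Ga y -> abs_inflow y < +oo}.
Proof.
have : {ae mu, forall y, Ga y -> abs_flux y < +oo}.
  by apply: ge0_integral_lty_ae abs_flux_lty => //; exact: measurable_funTS.
apply: filterS2 exit_rate_lty => y + + Gy => /(_ Gy) ky /(_ Gy) hy.
apply: le_lt_trans (abs_inflow_le y) _; rewrite lte_add_pinfty// lte_mul_pinfty//.
Qed.

(** Finiteness of [abs_inflow y] and [exit_rate y] is what allows the flux integral to be separated
    into its two parts. *)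
Lemma boundary_fluxE : {ae mu, forall y, Ga y -> inflow y \is a fin_num /\
  \int[mu]_(x in Om) (u x * ga (x, y) - u y * ga (y, x))%:E =
  inflow y - (u y)%:E * exit_rate y}.
Proof.
apply: filterS2 abs_inflow_lty exit_rate_lty => y + + Gy => /(_ Gy) Uy /(_ Gy) ky.
split; first by rewrite fin_num_abs (le_lt_trans (abse_inflow_le y)).
rewrite -ge0_integralZl_real//; last 2 first.
  by apply/measurable_EFinP/measurable_funTS; meas.
  by move=> z _; rewrite lee_fin.
have iin : mu.-integrable Om (fun x => (u x * ga (x, y))%:E).
  by apply/integrableP; split => //; apply/measurable_EFinP/measurable_funTS; meas.
have iout : mu.-integrable Om (fun x => (ga (y, x))%:E).
  apply/integrableP; split; first by apply/measurable_EFinP/measurable_funTS; meas.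
  by under eq_integral do rewrite gee0_abs ?lee_fin//.
by rewrite -integralB//; exact: integrableZl.
Qed.

Hypothesis robin : {ae mu, forall y, Ga y ->
  (u y)%:E = (r y * g y)%:E + (p y)%:E * inflow y}.


(** Tonelli alone suffices here. It identifies the quantity bounded in [return_weight_finite] with
    the absolute integral that Fubini needs in [integral_return_split]. *)
Lemma integral_return_weight x :
  \int[mu]_(z in Om) (`|u z|%:E * reflected_rate z x) =
  \int[mu]_(y in Ga) ((p y * ga (y, x))%:E * abs_inflow y).
Proof.
transitivity (\int[mu]_(z in Om) \int[mu]_(y in Ga)
    (p y * ga (y, x) * `|u z * ga (z, y)|)%:E).
  apply: eq_integral => z _; rewrite /reflected_rate -ge0_integralZl//.
  - apply: eq_integral => y _; rewrite -EFinM normrM (ger0_norm (ga0 _)).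
    by congr EFin; ring.
  - by apply/measurable_EFinP/measurable_funTS; meas.
  - by move=> y _; rewrite lee_fin !mulr_ge0.
rewrite (ge0_integral_setX_swap mu mu mOm mGa
  (f := fun w => (p w.2 * ga (w.2, x) * `|u w.1 * ga w|)%:E)).
- apply: eq_integral => y _ /=; rewrite /abs_inflow -ge0_integralZl//.
  + by apply: measurable_funTS; apply/measurable_EFinP/measurableT_comp => //; meas.
  + by rewrite lee_fin mulr_ge0.
- apply/measurable_EFinP; apply: measurable_funM; first by meas.
  by apply: measurableT_comp => //; meas.
- by move=> w; rewrite lee_fin !mulr_ge0.
Qed.

(** The Robin relation replaces [u y] by a source and a multiple of [inflow y]; Fubini turns the
    latter into an integral against the reflected rate. *)
Lemma integral_return_split x :
  mu.-integrable Ga (fun y => (g y * ga (y, x) * r y)%:E) ->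
  \int[mu]_(y in Ga) ((p y * ga (y, x))%:E * abs_inflow y) < +oo ->
  \int[mu]_(y in Ga) (u y * ga (y, x))%:E =
  \int[mu]_(y in Ga) (g y * ga (y, x) * r y)%:E +
  \int[mu]_(z in Om) ((u z)%:E * reflected_rate z x).
Proof.
move=> isrc Ufin.
have mpV : measurable_fun setT (fun y => (p y * ga (y, x))%:E * inflow y).
  apply: emeasurable_funM; last exact: measurable_inflow.
  by apply/measurable_EFinP; meas.
have mpU : measurable_fun setT (fun y => (p y * ga (y, x))%:E * abs_inflow y).
  apply: emeasurable_funM; last exact: measurable_abs_inflow.
  by apply/measurable_EFinP; meas.
have ipV : mu.-integrable Ga (fun y => (p y * ga (y, x))%:E * inflow y).
  apply/integrableP; split; first exact: measurable_funTS.
  apply: le_lt_trans Ufin; apply: ge0_le_integral => //.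
  - by apply: measurable_funTS; exact: measurableT_comp.
  - exact: measurable_funTS.
  - move=> y _; rewrite abseM gee0_abs ?lee_fin ?mulr_ge0//.
    by rewrite lee_wpmul2l ?abse_inflow_le// lee_fin mulr_ge0.
have -> : \int[mu]_(z in Om) ((u z)%:E * reflected_rate z x) =
    \int[mu]_(y in Ga) ((p y * ga (y, x))%:E * inflow y).
  transitivity (\int[mu]_(z in Om) \int[mu]_(y in Ga)
      (p y * ga (y, x) * (u z * ga (z, y)))%:E).
    apply: eq_integral => z _; rewrite /reflected_rate -ge0_integralZl_real//.
    - by apply: eq_integral => y _; rewrite -EFinM; congr EFin; ring.
    - by apply/measurable_EFinP/measurable_funTS; meas.
    - by move=> y _; rewrite lee_fin !mulr_ge0.
  rewrite (integral_setX_swap (m1 := mu) (m2 := mu) mOm mGa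
    (f := fun w => (p w.2 * ga (w.2, x) * (u w.1 * ga w))%:E)).
  - apply: ae_eq_integral => //.
    + apply: measurable_funTS; apply: (measurable_fun_integral2 mu
        (f := fun w => (p w.2 * ga (w.2, x) * (u w.1 * ga w))%:E)) => //.
      by apply/measurable_EFinP; meas.
    + exact: measurable_funTS.
    apply: filterS abs_inflow_lty => y + Gy => /(_ Gy) Uy /=.
    under eq_integral do rewrite EFinM.
    rewrite integralZl//; apply/integrableP; split.
      by apply/measurable_EFinP/measurable_funTS; meas.
    exact: Uy.
  - by apply/measurable_EFinP; meas.
  apply: le_lt_trans Ufin; rewrite -integral_return_weight.
  rewrite le_eqVlt; apply/orP; left; apply/eqP.
  apply: eq_integral => z _; rewrite /reflected_rate -ge0_integralZl//.
  - apply: eq_integral => y _ /=; rewrite -EFinM !normrM !(ger0_norm (ga0 _)).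
    by rewrite (ger0_norm (p0 _)); congr EFin; ring.
  - by apply/measurable_EFinP/measurable_funTS; meas.
  - by move=> y _; rewrite lee_fin !mulr_ge0.
rewrite -integralD//; apply: ae_eq_integral => //.
- by apply/measurable_EFinP/measurable_funTS; meas.
- apply: emeasurable_funD; last exact: measurable_funTS.
  exact: measurable_int isrc.
apply: filterS2 robin abs_inflow_lty => y + + Gy => /(_ Gy) uy /(_ Gy) Uy.
have Vfin : inflow y \is a fin_num.
  by rewrite fin_num_abs (le_lt_trans (abse_inflow_le y)).
move: uy; rewrite -(fineK Vfin) -!EFinM -!EFinD => -[->].
by congr EFin; ring.
Qed.

(** * Assembly of the operator for the measurable kernel *)

Hypothesis Om_Ga : Om `&` Ga = set0.
Hypothesis no_return : {ae mu, forall x, Om x ->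
  {ae mu, forall y, (~` (Om `|` Ga)) y -> ga (y, x) = 0%R}}.

Lemma nonlocal_operator_split : {ae mu, forall x, Om x ->
  \int[mu]_y (u x * ga (x, y) - u y * ga (y, x))%:E =
  \int[mu]_(z in Om) ((u x)%:E * ((ga (x, z))%:E + reflected_rate x z) -
                      (u z)%:E * ((ga (z, x))%:E + reflected_rate z x)) +
  (u x)%:E * (\int[mu]_(y in ~` (Om `|` Ga)) (ga (x, y))%:E +
              \int[mu]_(y in Ga) (q y * ga (x, y))%:E) -
  \int[mu]_(y in Ga) (g y * ga (y, x) * r y)%:E}.
Proof.
have := ae_and (ae_and ae_flux escape_int) (ae_and (ae_and
  return_weight_finite ae_return) (ae_and no_return integrable_source)).
apply: filterS => x [[fx ex] [[wx rx] [nx sx]]] Ox.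
move: (fx Ox) (ex Ox) (wx Ox) (rx Ox) (nx Ox) (sx Ox) => {}fx {}ex {}wx {}rx {}nx {}sx.
pose Xi := ~` (Om `|` Ga); pose f y := (u x * ga (x, y) - u y * ga (y, x))%:E.
have mf : measurable_fun setT f by exact: measurable_int fx.
have mOG : measurable (Om `|` Ga) by exact: measurableU.
have mXi : measurable Xi by exact: measurableC.
have mgax D : measurable_fun D (fun y => (ga (x, y))%:E).
  by apply/measurable_EFinP/measurable_funTS; meas.
have fD D : measurable D -> mu.-integrable D f.
  by move=> mD; exact: integrableS fx.
(* Integrability of the full flux permits cutting the space into [Om], [Ga] and the rest. *)
have split_f : \int[mu]_y f y =
    \int[mu]_(y in Om) f y + \int[mu]_(y in Ga) f y + \int[mu]_(y in Xi) f y.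
  rewrite -[X in integral _ X _](setUv (Om `|` Ga)) integral_setU//; last 2 first.
    by apply: measurable_funS mf.
    by apply/disj_setPS; rewrite setICr.
  rewrite integral_setU//; first exact: measurable_funTS.
  by apply/disj_setPS; rewrite Om_Ga.
have fXi : \int[mu]_(y in Xi) f y = (u x)%:E * \int[mu]_(y in Xi) (ga (x, y))%:E.
  rewrite -ge0_integralZl_real//; last by move=> y _; rewrite lee_fin.
  apply: ae_eq_integral => //; [exact: measurable_funTS|exact: measurable_funeM|].
  by apply: filterS nx => y + Xy => /(_ Xy) ga_yx; rewrite /f ga_yx mulr0 subr0.
have fGa : \int[mu]_(y in Ga) f y =
    (u x)%:E * \int[mu]_(y in Ga) (ga (x, y))%:E -
    \int[mu]_(y in Ga) (u y * ga (y, x))%:E.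
  rewrite -ge0_integralZl_real//; last by move=> y _; rewrite lee_fin.
  by rewrite -integralB_EFin//; exact: integrable_escape.
have mK1 : measurable_fun Om (reflected_rate x).
  by apply: measurable_funTS; exact: measurable_reflected_rate1.
have mK2 : measurable_fun Om (fun z => (u z)%:E * reflected_rate z x).
  apply: measurable_funTS; apply: emeasurable_funM;
    last exact: measurable_reflected_rate2.
  exact/measurable_EFinP.
have iq0 : 0 <= \int[mu]_(y in Ga) (q y * ga (x, y))%:E.
  by apply: integral_ge0 => y _; rewrite lee_fin mulr_ge0.
have iK0 : 0 <= \int[mu]_(z in Om) reflected_rate x z.
  by apply: integral_ge0 => z _; exact: reflected_rate_ge0.
(* The reflected mass is a part of the escape mass, which is finite. *)
have iK1 : mu.-integrable Om (reflected_rate x).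
  apply/integrableP; split => //; apply: le_lt_trans ex.
  under eq_integral do rewrite gee0_abs ?reflected_rate_ge0//.
  by rewrite integral_escape_split leeDl.
have iK2 : mu.-integrable Om (fun z => (u z)%:E * reflected_rate z x).
  apply/integrableP; split => //; apply: le_lt_trans wx.
  rewrite -integral_return_weight.
  under eq_integral do rewrite abseM (gee0_abs (reflected_rate_ge0 _ _)).
  by [].
have fOm : \int[mu]_(z in Om) ((u x)%:E * ((ga (x, z))%:E + reflected_rate x z) -
                      (u z)%:E * ((ga (z, x))%:E + reflected_rate z x)) =
    \int[mu]_(z in Om) f z + ((u x)%:E * \int[mu]_(z in Om) reflected_rate x z -
      \int[mu]_(z in Om) ((u z)%:E * reflected_rate z x)).
  have iuK : mu.-integrable Om (fun z => (u x)%:E * reflected_rate x z).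
    exact: integrableZl.
  rewrite -integralZl// -integralB// -integralD//; [|exact: fD|exact: integrableB].
  apply: ae_eq_integral => //.
  - apply: emeasurable_funB; [apply: measurable_funeM|apply: emeasurable_funM].
    + exact: emeasurable_funD.
    + exact/measurable_EFinP/measurable_funTS.
    + apply: emeasurable_funD; first by apply/measurable_EFinP/measurable_funTS; meas.
      by apply: measurable_funTS; exact: measurable_reflected_rate2.
  - apply: emeasurable_funD; first exact: measurable_funTS.
    exact: measurable_int (integrableB mOm iuK iK2).
  (* Expanding the products needs finite reflected terms to avoid a difference of infinities; they
     are finite for almost every [z]. *)
  apply: filterS2 (integrable_ae mOm iuK) (integrable_ae mOm iK2).
  move=> z /= + + Oz => /(_ Oz) + /(_ Oz).
  rewrite [X in X - _ = _]muleDr ?fin_num_adde_defr//.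
  rewrite [X in _ - X = _]muleDr ?fin_num_adde_defr//.
  move: ((u x)%:E * reflected_rate x z) ((u z)%:E * reflected_rate z x).
  move=> [a| |] [b| |]// _ _.
  by rewrite /f -!EFinM -!EFinD; congr EFin; ring.
(* Once every integral is known to be finite, the claim is an identity between real numbers, in
   which [a] is the killed and [b] the reflected mass, [s] the source and [c] the reflected
   return. *)
have := integrable_fin_num mXi (fD _ mXi).
have := integrable_fin_num mOm (fD _ mOm).
have := integrable_fin_num mGa sx.
have := integrable_fin_num mOm iK2.
have := integrable_fin_num mOm iK1.
have : \int[mu]_(y in Ga) (q y * ga (x, y))%:E \is a fin_num.
  by rewrite ge0_fin_numE// (le_lt_trans _ ex)// integral_escape_split leeDr.
rewrite [LHS]split_f fOm fGa fXi integral_escape_split integral_return_split//.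
rewrite [X in _ + X - _]muleDr//; last first.
  by rewrite ge0_adde_def// inE// integral_ge0// => y _; rewrite lee_fin.
move: (\int[mu]_(y in Ga) (q y * ga (x, y))%:E) => [a| |]// _.
move: (\int[mu]_(z in Om) reflected_rate x z) => [b| |]// _.
move: (\int[mu]_(z in Om) ((u z)%:E * reflected_rate z x)) => [c| |]// _.
move: (\int[mu]_(y in Ga) _) => [s| |]// _.
move: (\int[mu]_(z in Om) f z) => [e| |]// _.
move: ((u x)%:E * _) => [t| |]// _.
suff /(congr1 (@EFin R)) : (e + (u x * (b + a) - (s + c)) + t =
    e + (u x * b - c) + (t + u x * a) - s)%R by [].
by ring.
Qed.

End robin_substitution.

(** * Replacing the kernel by a product-measurable one *)

Section representative.
Context {R : realType} {disp : measure_display} {T : measurableType disp}.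
Variable mu : {sigma_finite_measure set T -> \bar R}.
Hypothesis cmu : measure_is_complete mu.
Variables (Omega Gamma Gamma_hat : set T) (gamma ga : T * T -> R).
Variables (u alpha g : T -> R).
Hypothesis GammaE : forall y, Gamma y <->
  ~ Omega y /\ 0 < \int[mu]_(x in Omega) (gamma (y, x))%:E.
Hypothesis Gamma_hatE : forall y, Gamma_hat y <->
  ~ Omega y /\ 0 < \int[mu]_(x in Omega) (gamma (y, x) + gamma (x, y))%:E.
Hypothesis mOm : measurable Omega.
Hypothesis gamma_ge0 : forall w, (0 <= gamma w)%R.
Hypothesis ga_ge0 : forall w, (0 <= ga w)%R.
Hypothesis mga : measurable_fun setT ga.
Hypothesis gaE1 : {ae mu, forall x, {ae mu, forall y, gamma (x, y) = ga (x, y)}}.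
Hypothesis gaE2 : {ae mu, forall y, {ae mu, forall x, gamma (x, y) = ga (x, y)}}.

(** * Boundary sets and rates expressed through the representative *)

Let mga1 x : measurable_fun setT (fun y => ga (x, y)).
Proof. exact: measurable_fun_pair2. Qed.

Let mga2 y : measurable_fun setT (fun x => ga (x, y)).
Proof. exact: measurable_fun_pair1. Qed.

Let exit_rateE : {ae mu, forall y,
  \int[mu]_(x in Omega) (gamma (y, x))%:E = exit_rate mu Omega ga y}.
Proof.
apply: filterS gaE1 => y yE; apply/esym/ae_eq_integral_complete => //.
  exact/measurable_EFinP/measurable_funTS.
by apply: filterS yE => x ->.
Qed.

Let mexit : measurable_fun setT (exit_rate mu Omega ga).
Proof. exact: measurable_exit_rate. Qed.

(** [Gamma] agrees almost everywhere with the set defined from [ga], which is measurable by Tonelli;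
    completeness does the rest. *)
Lemma measurable_Gamma : measurable Gamma.
Proof.
pose G := ~` Omega `&` [set y | 0 < exit_rate mu Omega ga y].
apply: (ae_measurable_set cmu (A := G)).
  apply: measurableI; first exact: measurableC.
  by rewrite -[X in measurable X]setTI; exact: emeasurable_fun_o_infty.
apply: filterS exit_rateE => y yE.
by rewrite GammaE yE.
Qed.

Let mGa : measurable Gamma := measurable_Gamma.

(** The transposed kernel: its exit rate at [y] is the rate of arrival at [y] from [Omega]. *)
Let ga' (w : T * T) : R := ga (w.2, w.1).

Let ga'_ge0 w : (0 <= ga' w)%R.
Proof. exact: ga_ge0. Qed.

Let mga' : measurable_fun setT ga'.
Proof. by apply: (measurableT_comp mga); exact: measurable_swap. Qed.

Let sym_rateE : {ae mu, forall y,
  \int[mu]_(x in Omega) (gamma (y, x) + gamma (x, y))%:E =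
  exit_rate mu Omega ga y + exit_rate mu Omega ga' y}.
Proof.
apply: filterS2 gaE1 gaE2 => y E1 E2.
have mE1 : measurable_fun Omega (fun x => (ga (y, x))%:E).
  exact/measurable_EFinP/measurable_funTS.
have mE2 : measurable_fun Omega (fun x => (ga' (y, x))%:E).
  by apply/measurable_EFinP/measurable_funTS; exact: mga2.
rewrite -ge0_integralD//; last 2 first.
- by move=> x _; rewrite lee_fin.
- by move=> x _; rewrite lee_fin ga'_ge0.
apply/esym/ae_eq_integral_complete => //.
  exact: emeasurable_funD.
by apply: filterS2 E1 E2 => x -> -> _; rewrite EFinD.
Qed.

Lemma measurable_Gamma_hat : measurable Gamma_hat.
Proof.
pose G := ~` Omega `&`
  [set y | 0 < exit_rate mu Omega ga y + exit_rate mu Omega ga' y].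
apply: (ae_measurable_set cmu (A := G)).
  apply: measurableI; first exact: measurableC.
  rewrite -[X in measurable X]setTI; apply: emeasurable_fun_o_infty => //.
  by apply: emeasurable_funD => //; exact: measurable_exit_rate.
by apply: filterS sym_rateE => y yE; rewrite Gamma_hatE yE.
Qed.

Let Xi := ~` (Omega `|` Gamma).

Let mXi : measurable Xi.
Proof. by apply: measurableC; exact: measurableU. Qed.

Let no_return : {ae mu, forall x, Omega x ->
  {ae mu, forall y, Xi y -> ga (y, x) = 0%R}}.
Proof.
apply: (exit_rate_eq0_ae mOm ga_ge0 mga mXi).
apply: filterS exit_rateE => y <- /not_orP[nOy nGy].
apply/eqP; rewrite eq_le; apply/andP; split.
  by rewrite leNgt; apply/negP => y0; apply/nGy/GammaE.
by apply: integral_ge0 => x _; rewrite lee_fin.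
Qed.

(** Outside [Omega] and [Gamma_hat] the symmetrized rate is zero, hence so is the exit rate of
    [ga'], and almost no mass from [Omega] lands there. *)
Let Xi_escape : {ae mu, forall x, Omega x ->
  \int[mu]_(y in Xi) (ga (x, y))%:E =
  \int[mu]_(y in Gamma_hat `\` Gamma) (gamma (x, y))%:E}.
Proof.
have mXG : measurable (Xi `\` Gamma_hat).
  by apply: measurableD => //; exact: measurable_Gamma_hat.
have mGG : measurable (Gamma_hat `\` Gamma).
  by apply: measurableD => //; exact: measurable_Gamma_hat.
have no_escape : {ae mu, forall x, Omega x ->
    {ae mu, forall y, (Xi `\` Gamma_hat) y -> ga' (y, x) = 0%R}}.
  apply: (exit_rate_eq0_ae mOm ga'_ge0 mga' mXG).
  apply: filterS sym_rateE => y yE [/not_orP[nOy _] nGy].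
  have := exit_rate_ge0 mu Omega ga_ge0 y.
  have := exit_rate_ge0 mu Omega ga'_ge0 y.
  move=> e'0 e0; apply/eqP; rewrite eq_le e'0 andbT leNgt; apply/negP => e'gt0.
  apply: nGy; apply/Gamma_hatE; split => //.
  by rewrite yE (lt_le_trans e'gt0)// leeDr.
apply: filterS2 no_escape gaE1 => x + xE Ox => /(_ Ox) ga'0.
have XiE : Xi = (Gamma_hat `\` Gamma) `|` (Xi `\` Gamma_hat).
  apply/seteqP; split => [y Xy|y [[/Gamma_hatE[nOy _] nGy]|[]//]]; last by case.
  have [Gy|nGy] := pselect (Gamma_hat y); [left|by right].
  by split => // Gy'; apply: Xy; right.
have mgax D : measurable_fun D (fun y => (ga (x, y))%:E).
  exact/measurable_EFinP/measurable_funTS.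
rewrite XiE integral_setU//; last by apply/disj_setPS => y [[? _] []].
rewrite [X in _ + X = _](_ : _ = 0) ?adde0; last first.
  rewrite (ae_eq_integral (cst 0)) ?integral0//.
  by apply: filterS ga'0 => y + Xy => /(_ Xy); rewrite /ga' /= => ->.
apply: ae_eq_integral_complete => //.
by apply: filterS xE => y ->.
Qed.

(** * Coefficients of the Robin condition *)

Hypothesis escape_lty : {ae mu, forall x, Omega x ->
  (exists C : R, {ae mu, forall y, Gamma y -> (gamma (y, x) <= C)%R}) /\
  \int[mu]_(y in Gamma) (gamma (x, y))%:E < +oo}.
Hypothesis entry_lty : {ae mu, forall y, Gamma y ->
  \int[mu]_(x in Omega) (gamma (y, x))%:E < +oo}.
Hypothesis meas_u : measurable_fun setT u.
Hypothesis flux_lty : \int[mu]_(x in Omega)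
  \int[mu]_y `|u x * gamma (x, y) - u y * gamma (y, x)|%:E < +oo.
Hypothesis alpha01 : forall y, Gamma y -> (0 <= alpha y <= 1)%R.
Hypothesis malpha : measurable_fun Gamma alpha.
Hypothesis g_int : mu.-integrable Gamma (EFin \o g).
Hypothesis robin : forall y, Gamma y ->
  (alpha y * u y)%:E - (1 - alpha y)%:E *
    \int[mu]_(x in Omega) (u x * gamma (x, y) - u y * gamma (y, x))%:E = (g y)%:E.

Local Notation den y := ((1 - alpha y)%:E *
  \int[mu]_(v in Omega) (gamma (y, v))%:E + (alpha y)%:E).
Local Notation gamma_al x z := ((gamma (x, z))%:E + \int[mu]_(y in Gamma)
  (((1 - alpha y) * gamma (x, y) * gamma (y, z))%:E / den y)).

(** Extension by zero gives functions that are measurable on the whole space, and keeps [a] between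
    0 and 1 everywhere, so that [p], [q] and [r] are nonnegative at every point. *)
Let a : T -> R := alpha \_ Gamma.
Let g' : T -> R := g \_ Gamma.
Let k y : R := fine (exit_rate mu Omega ga y).
Let D y : R := ((1 - a y) * k y + a y)%R.
(* A power rather than [(D y)^-1], because the library has [measurable_powR] *)
Let r y : R := ((D y) `^ (-1))%R.
Let p y : R := ((1 - a y) * r y)%R.
Let q y : R := (a y * r y)%R.

Let ma : measurable_fun setT a.
Proof. exact/(measurable_restrictT _ _).1. Qed.

Let mg' : measurable_fun setT g'.
Proof.
apply/(measurable_restrictT _ _).1 => //.
by apply/measurable_EFinP; exact: measurable_int g_int.
Qed.

Let a01 y : (0 <= a y <= 1)%R.
Proof.
rewrite /a patchE; case: ifPn => [/[!inE] /alpha01 //|_].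
by rewrite lexx ler01.
Qed.

Let k_ge0 y : (0 <= k y)%R.
Proof. by apply: fine_ge0; exact: exit_rate_ge0. Qed.

Let D_ge0 y : (0 <= D y)%R.
Proof. by have /andP[a0 a1] := a01 y; rewrite addr_ge0// mulr_ge0// subr_ge0. Qed.

(** Where [D] vanishes, both sides are 0 by convention. *)
Let rE y : r y = ((D y)^-1)%R.
Proof. by rewrite /r powR_inv1. Qed.

Let mk : measurable_fun setT k.
Proof. by apply: measurableT_comp => //. Qed.

Let mr : measurable_fun setT r.
Proof.
apply: (measurableT_comp (measurable_powR (R := R) (-1))).
apply: measurable_funD => //; apply: measurable_funM => //.
exact: measurable_funB.
Qed.

Let mp : measurable_fun setT p.
Proof. by apply: measurable_funM => //; exact: measurable_funB. Qed.

Let mq : measurable_fun setT q.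
Proof. exact: measurable_funM. Qed.

Let r_ge0 y : (0 <= r y)%R.
Proof. exact: powR_ge0. Qed.

Let p_ge0 y : (0 <= p y)%R.
Proof. by have /andP[a0 a1] := a01 y; rewrite mulr_ge0// subr_ge0. Qed.

Let q_ge0 y : (0 <= q y)%R.
Proof. by have /andP[a0 a1] := a01 y; rewrite mulr_ge0. Qed.

Let aE y : Gamma y -> a y = alpha y.
Proof. by move=> Gy; rewrite /a patchE mem_set. Qed.

Let g'E y : Gamma y -> g' y = g y.
Proof. by move=> Gy; rewrite /g' patchE mem_set. Qed.

Let boundary : {ae mu, forall y, Gamma y ->
  [/\ exit_rate mu Omega ga y = (k y)%:E, (0 < D y)%R & den y = (D y)%:E]}.
Proof.
apply: filterS2 exit_rateE entry_lty => y yE + Gy => /(_ Gy).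
have [_] := (GammaE y).1 Gy; rewrite yE => e0 elty.
have kE : exit_rate mu Omega ga y = (k y)%:E by rewrite fineK// gt0_fin_numE.
move: e0; rewrite kE lte_fin => k0; have /andP[a0 a1] := a01 y.
split => //; last by rewrite -!aE.
(* On [Gamma] the rate [k] is positive, so [D y = 0] would force [a y] to be both 0 and 1. *)
rewrite lt_neqAle D_ge0 andbT eq_sym /D paddr_eq0 ?mulr_ge0 ?subr_ge0//.
rewrite mulf_eq0 (gt_eqF k0) orbF subr_eq0.
by have [->|] := eqVneq (a y) 0%R; rewrite ?andbF// oner_eq0.
Qed.

Let pkq1 : {ae mu, forall y, Gamma y ->
  (p y)%:E * exit_rate mu Omega ga y + (q y)%:E = 1}.
Proof.
apply: filterS boundary => y + Gy => /(_ Gy)[-> D0 _].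
rewrite -EFinM -EFinD; congr EFin; rewrite /p /q rE.
by rewrite mulrAC -mulrDl divff// gt_eqF.
Qed.

(** If [a >= 1/2] then [D >= 1/2]; otherwise [2 D >= 2 (1 - a) k >= k]. *)
Let rk : {ae mu, forall y, Gamma y ->
  (r y <= 2)%R \/ (r y)%:E * exit_rate mu Omega ga y <= 2%:E}.
Proof.
apply: filterS boundary => y + Gy => /(_ Gy)[-> D0 _].
have /andP[a0 a1] := a01 y; rewrite rE -EFinM lee_fin.
have [ha|ha] := leP 2^-1%R (a y); [left|right].
  rewrite -[leRHS]invrK lef_pV2 ?posrE ?invr_gt0//.
  by rewrite (le_trans ha)// lerDr mulr_ge0 ?subr_ge0.
rewrite mulrC ler_pdivrMr// /D mulrDr.
have : (0 <= (1 - 2 * a y) * k y)%R.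
  by rewrite mulr_ge0// subr_ge0 mulrC -ler_pdivlMr// div1r ltW.
by lra.
Qed.

Let ga_bounded : {ae mu, forall x, Omega x ->
  exists C : R, {ae mu, forall y, Gamma y -> (ga (y, x) <= C)%R}}.
Proof.
apply: filterS2 escape_lty gaE2 => x + xE Ox => /(_ Ox)[[C gC] _]; exists C.
by apply: filterS2 gC xE => y + <-.
Qed.

(** A single exceptional null set serves every [A]: off it, both sections of gamma agree almost
    everywhere with those of [ga]. *)
Let fluxE : {ae mu, forall x, forall A, measurable A ->
  \int[mu]_(y in A) (u x * gamma (x, y) - u y * gamma (y, x))%:E =
  \int[mu]_(y in A) (u x * ga (x, y) - u y * ga (y, x))%:E /\
  \int[mu]_(y in A) `|u x * gamma (x, y) - u y * gamma (y, x)|%:E =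
  \int[mu]_(y in A) `|u x * ga (x, y) - u y * ga (y, x)|%:E}.
Proof.
apply: filterS2 gaE1 gaE2 => x E1 E2 A mA.
have mf : measurable_fun setT (fun y => u x * ga (x, y) - u y * ga (y, x))%R.
  by apply: measurable_funB; apply: measurable_funM => //; exact: measurable_cst.
split; apply/esym/ae_eq_integral_complete => //.
- exact/measurable_EFinP/measurable_funTS.
- by apply: filterS2 E1 E2 => y -> ->.
- by apply/measurable_EFinP/measurable_funTS; exact: measurableT_comp.
- by apply: filterS2 E1 E2 => y -> ->.
Qed.

Let flux_lty' : \int[mu]_(x in Omega)
  \int[mu]_y `|u x * ga (x, y) - u y * ga (y, x)|%:E < +oo.
Proof.
rewrite (ae_eq_integral_complete (g := fun x =>
  \int[mu]_y `|u x * gamma (x, y) - u y * gamma (y, x)|%:E) cmu mOm)//; last first.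
  by apply: filterS fluxE => x /(_ _ measurableT)[_ ->].
apply: measurable_funTS.
apply: (measurable_fun_integral1 mu measurableT
  (f := fun w => `|u w.1 * ga w - u w.2 * ga (w.2, w.1)|%:E)).
apply/measurable_EFinP; apply: measurableT_comp => //.
by apply: measurable_funB; apply: measurable_funM => //; exact: measurableT_comp.
Qed.

Let escape_lty' : {ae mu, forall x, Omega x ->
  \int[mu]_(y in Gamma) (ga (x, y))%:E < +oo}.
Proof.
apply: filterS2 escape_lty gaE1 => x + xE Ox => /(_ Ox)[_].
rewrite -(ae_eq_integral_complete (f := fun y => (ga (x, y))%:E) cmu mGa)//.
  exact/measurable_EFinP/measurable_funTS.
by apply: filterS xE => y ->.
Qed.

Let exit_lty : {ae mu, forall y, Gamma y -> exit_rate mu Omega ga y < +oo}.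
Proof. by apply: filterS boundary => y + Gy => /(_ Gy)[-> _ _]; rewrite ltry. Qed.

(** With the flux separated by [boundary_fluxE], the condition reads [u D = g + (1 - a) V], and [D]
    is positive almost everywhere on [Gamma]. *)
Let robin' : {ae mu, forall y, Gamma y -> (u y)%:E =
  (r y * g' y)%:E + (p y)%:E * inflow mu Omega ga u y}.
Proof.
have := ae_and (ae_and gaE1 gaE2) (ae_and boundary
  (boundary_fluxE mOm mGa ga_ge0 mga meas_u flux_lty' exit_lty)).
apply: filterS => y [[E1 E2] [bE vE]] Gy; have [kE D0 _] := bE Gy.
have [vfin fluxv] := vE Gy; have := robin Gy.
have -> : \int[mu]_(x in Omega) (u x * gamma (x, y) - u y * gamma (y, x))%:E =
    inflow mu Omega ga u y - (u y)%:E * exit_rate mu Omega ga y.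
  rewrite -fluxv; apply/esym/ae_eq_integral_complete => //.
    apply/measurable_EFinP/measurable_funTS.
    by apply: measurable_funB; apply: measurable_funM => //; exact: mga2.
  by apply: filterS2 E1 E2 => x -> ->.
rewrite kE -(fineK vfin) g'E// -!(aE Gy).
set v := fine _ => gE.
have {}gE : (a y * u y - (1 - a y) * (v - u y * k y) = g y)%R.
  by apply: EFin_inj; rewrite -gE.
have uD : (u y * D y = g y + (1 - a y) * v)%R by rewrite -gE /D; ring.
suff /(congr1 (@EFin R)) : (u y = r y * g y + p y * v)%R by [].
have Dn0 : (D y != 0)%R by rewrite gt_eqF.
by rewrite -[LHS](mulfK Dn0) uD /p rE; ring.
Qed.

Lemma nonlocal_operator_representative : {ae mu, forall x, Omega x ->
  \int[mu]_y (u x * gamma (x, y) - u y * gamma (y, x))%:E =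
  \int[mu]_(z in Omega) ((u x)%:E * gamma_al x z - (u z)%:E * gamma_al z x) +
  (u x)%:E * (\int[mu]_(y in Gamma_hat `\` Gamma) (gamma (x, y))%:E +
    \int[mu]_(y in Gamma) ((alpha y * gamma (x, y))%:E / den y)) -
  \int[mu]_(y in Gamma) ((g y * gamma (y, x))%:E / den y)}.
Proof.
have Om_Ga : Omega `&` Gamma = set0.
  by apply/seteqP; split => // y [Oy /GammaE[]].
have g'_int : mu.-integrable Gamma (EFin \o g').
  apply: eq_integrable g_int => // y /[!inE] Gy /=.
  by rewrite g'E.
have main := nonlocal_operator_split mOm mGa ga_ge0 mga meas_u mg' mp mq mr
  p_ge0 q_ge0 r_ge0 pkq1 rk ga_bounded g'_int flux_lty' escape_lty' exit_lty
  robin' Om_Ga no_return.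
have den_inv y (c : R) : (0 < D y)%R -> den y = (D y)%:E ->
    c%:E / den y = (c * r y)%:E.
  by move=> D0 ->; rewrite inver gt_eqF// rE EFinM.
(* Besides the two sections, the value at [(x, z)] itself must agree, since it enters outside the
   integral. *)
have gamma_alE x z : {ae mu, forall y, gamma (x, y) = ga (x, y)} ->
    {ae mu, forall y, gamma (y, z) = ga (y, z)} -> gamma (x, z) = ga (x, z) ->
    gamma_al x z = (ga (x, z))%:E + reflected_rate mu Gamma ga p x z.
  move=> xE zE ->; congr (_ + _); apply/esym/ae_eq_integral_complete => //.
    apply/measurable_EFinP/measurable_funTS; apply: measurable_funM => //.
    exact: measurable_funM.
  have := ae_and boundary (ae_and xE zE).
  apply: filterS => y [bE [-> ->]] Gy; have [_ D0 dE] := bE Gy.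
  by rewrite den_inv// -aE// /p; congr EFin; ring.
have := ae_and (ae_and main Xi_escape) (ae_and fluxE (ae_and gaE1 gaE2)).
apply: filterS => x [[xmain xXi] [xflux [E1 E2]]] Ox.
have [-> _] := xflux _ measurableT.
rewrite (xmain Ox) (xXi Ox).
congr (_ - _); [congr (_ + _); [|congr (_ * (_ + _))]|].
- apply: ae_eq_integral_complete => //.
    apply: measurable_funTS.
    have mrr1 := measurable_reflected_rate1 mu mGa mga mp x.
    have mrr2 := measurable_reflected_rate2 mu mGa mga mp x.
    apply: emeasurable_funB.
      by apply: measurable_funeM; apply: emeasurable_funD => //; exact/measurable_EFinP.
    apply: emeasurable_funM; first exact/measurable_EFinP.
    by apply: emeasurable_funD => //; apply/measurable_EFinP; exact: mga2.
  (* Both sections at [z] are needed too, because [gamma_al x z] and [gamma_al z x] both occur. *)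
  have := ae_and (ae_and gaE1 gaE2) (ae_and E1 E2).
  apply: filterS => z [[zE1 zE2] [xz zx]] _.
  by rewrite !gamma_alE.
- apply: ae_eq_integral_complete => //.
    by apply/measurable_EFinP/measurable_funTS; exact: measurable_funM.
  have := ae_and boundary E1.
  apply: filterS => y [bE ->] Gy; have [_ D0 dE] := bE Gy.
  by rewrite den_inv// -aE// /q mulrAC.
- apply: ae_eq_integral_complete => //.
    apply/measurable_EFinP/measurable_funTS; apply: measurable_funM => //.
    by apply: measurable_funM => //; exact: mga2.
  have := ae_and boundary E2.
  apply: filterS => y [bE ->] Gy; have [_ D0 dE] := bE Gy.
  by rewrite den_inv// g'E.
Qed.

End representative.

(** * Choice of the representative and passage to Lebesgue measure *)

Lemma completed_product_representative {R : realType} {disp : measure_display}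
    {T : measurableType disp} (mu : {sigma_finite_measure set T -> \bar R})
    (f : T * T -> R) : (forall w, 0 <= f w)%R ->
  measurable_fun [set: caratheodory_type (mu_ext (mu \x mu))]
    (f : caratheodory_type (mu_ext (mu \x mu)) -> R) ->
  exists f' : T * T -> R, [/\ measurable_fun setT f', (forall w, 0 <= f' w)%R,
    {ae mu, forall x, {ae mu, forall y, f (x, y) = f' (x, y)}} &
    {ae mu, forall y, {ae mu, forall x, f (x, y) = f' (x, y)}}].
Proof.
move=> f0 mf.
have sf : sigma_finite setT (mu \x mu).
  have /sigma_finiteP[F [FT ndF Foo]] := sigma_finiteT mu.
  (* The exhaustion is increasing, so squares suffice: both coordinates lie in the set with the
     larger index. *)
  exists (fun n => F n `*` F n) => [|n]; last first.
    have [mF Fn] := Foo n; split; first exact: measurableX.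
    by rewrite product_measure1E// lte_mul_pinfty// ge0_fin_numE.
  apply/seteqP; split=> // -[x y] _.
  have [[i _ Fx] [j _ Fy]] : (\bigcup_n F n) x /\ (\bigcup_n F n) y by rewrite -FT.
  exists (maxn i j) => //; split.
    by move: Fx; apply/subsetPset/ndF/leq_maxl.
  by move: Fy; apply/subsetPset/ndF/leq_maxr.
have [f' [mf' f'0 ff']] := caratheodory_ae_measurable_fun sf f0 mf.
exists f'; split => //; first exact: ae_product_xsection ff'.
exact: ae_product_ysection ff'.
Qed.

Lemma Linfty_norm_ge0 (R : realType) (d : nat) (A : set (Rd R d)) (f : Rd R d -> R) :
  0 <= Linfty_norm A f.
Proof. exact: Lnorm_ge0. Qed.

(** The essential supremum is itself an almost everywhere bound; this is the form in which the norm
    hypothesis enters. *)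
Lemma Linfty_norm_bound (R : realType) (d : nat) (A : set (Rd R d)) (f : Rd R d -> R) :
  (forall y, 0 <= f y)%R -> Linfty_norm A f < +oo ->
  exists C : R, {ae leb, forall y, A y -> (f y <= C)%R}.
Proof.
move=> f0; have := Linfty_norm_ge0 A f; rewrite /Linfty_norm unlock.
case: ifPn => [leb0|]; last first.
  (* If the whole space is null, the norm is a default value, and any constant is a bound almost
     everywhere. *)
  rewrite lt0e measure_ge0 andbT negbK => /eqP leb0 _ _.
  by exists 0%R; exists setT; split.
move=> N0 Noo; exists (fine (ess_sup leb (abse \o (EFin \o f) \_ A))).
apply: filterS (ess_sup_ge leb (abse \o (EFin \o f) \_ A)) => y + Ay.
rewrite /= patchE mem_set//= ger0_norm// -lee_fin fineK//.
by rewrite ge0_fin_numE.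
Qed.

Theorem theorem6p2 (R : realType) (d : nat)
    (Omega : set (Rd R d)) (gamma : Rd R d * Rd R d -> R)
    (u alpha g : Rd R d -> R) :
  let Gamma := nonlocal_boundary Omega gamma in
  let Gamma_hat := nonlocal_boundary_sym Omega gamma in
  open Omega -> Omega !=set0 ->
  (forall p, (0 <= gamma p)%R) ->
  measurable_fun [set: RdRd R d] (gamma : RdRd R d -> R) ->
  {ae leb, forall x, Omega x ->
    Linfty_norm Gamma (fun y => gamma (y, x)) +
    \int[leb]_(y in Gamma) (gamma (x, y))%:E < +oo} ->
  {ae leb, forall y, Gamma y ->
    Linfty_norm Omega (fun x => gamma (x, y)) +
    \int[leb]_(x in Omega) (gamma (y, x))%:E < +oo} ->
  measurable_fun setT u ->
  \int[leb]_(x in Omega) `|u x|%:E < +oo ->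
  \int[leb]_(x in Omega)
    \int[leb]_y `|u x * gamma (x, y) - u y * gamma (y, x)|%:E < +oo ->
  (forall y, Gamma y -> (0 <= alpha y <= 1)%R) ->
  measurable_fun Gamma alpha ->
  leb.-integrable Gamma (EFin \o g) ->
  (forall y, Gamma y ->
    (alpha y * u y)%:E - (1 - alpha y)%:E *
      \int[leb]_(x in Omega) (u x * gamma (x, y) - u y * gamma (y, x))%:E
    = (g y)%:E) ->
  {ae leb, forall x, Omega x ->
    nonlocal_op gamma u x =
    \int[leb]_(z in Omega)
      ((u x)%:E * gamma_alpha Omega gamma alpha x z -
       (u z)%:E * gamma_alpha Omega gamma alpha z x)
    + (u x)%:E *
      (\int[leb]_(y in Gamma_hat `\` Gamma) (gamma (x, y))%:E +
       \int[leb]_(y in Gamma)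
         ((alpha y * gamma (x, y))%:E / robin_denom Omega gamma alpha y))
    - \int[leb]_(y in Gamma)
        ((g y * gamma (y, x))%:E / robin_denom Omega gamma alpha y)}.
Proof.
move=> Gamma Gamma_hat oOm _ gamma0 mgamma esc entry meas_u _ flux a01 ma gint rob.
have mOm := open_measurable_Rd oOm.
have [ga [mga ga0 gaE1 gaE2]] := completed_product_representative
  (mu := @leb R d) gamma0 mgamma.
have esc' : {ae leb, forall x, Omega x ->
    (exists C : R, {ae leb, forall y, Gamma y -> (gamma (y, x) <= C)%R}) /\
    \int[leb]_(y in Gamma) (gamma (x, y))%:E < +oo}.
  apply: filterS esc => x + Ox => /(_ Ox) sum_lty.
  have int0 : 0 <= \int[leb]_(y in Gamma) (gamma (x, y))%:E.
    by apply: integral_ge0 => y _; rewrite lee_fin.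
  have norm0 := Linfty_norm_ge0 Gamma (fun y => gamma (y, x)).
  split; last by rewrite (le_lt_trans _ sum_lty)// leeDr.
  apply: Linfty_norm_bound; first by move=> y; exact: gamma0.
  by rewrite (le_lt_trans _ sum_lty)// leeDl.
have entry' : {ae leb, forall y, Gamma y ->
    \int[leb]_(x in Omega) (gamma (y, x))%:E < +oo}.
  apply: filterS entry => y + Gy => /(_ Gy) sum_lty.
  by rewrite (le_lt_trans _ sum_lty)// leeDr// Linfty_norm_ge0.
exact: (@nonlocal_operator_representative R _ _ (@leb R d) (@leb_complete R d)
  Omega Gamma Gamma_hat gamma ga u alpha g (fun y => iff_refl _)
  (fun y => iff_refl _) mOm gamma0 ga0 mga gaE1 gaE2 esc' entry' meas_u flux
  a01 ma gint rob).
Qed.
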